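(* The collection of unstable manifolds $(W_I^-)_{I\subset\{1,\dots,n\}}$ defines a Whitney regular stratification of $\mathrm{Lag}_h(\widehat E)$. In particular, the flow $\Psi^t$ satisfies the Morse-Smale transversality condition (for all $I,K\subset\{1,\dots,n\}$ the manifolds $W_I^-$ and $W_K^+$ intersect transversally).
   Context: $E$ is a complex Hermitian vector space of dimension $n$ with a fixed orthonormal basis $e_1,\dots,e_n$; $\widehat E=E\oplus E$, $\mathbf e_i=(e_i,0)$, $\mathbf f_i=(0,e_i)$, $J(x,y)=(-y,x)$. $\mathrm{Lag}_h(\widehat E)$ is the set of complex subspaces $L\subset\widehat E$ with $L^\perp=JL$; it is a compact real analytic manifold of real dimension $n^2$ (a submanifold of the Grassmannian of $n$-planes in $\widehat E$), diffeomorphic to $U(E)$ via $S\mapsto\mathcal L_S=\{((1+S)x,-\mathbf i(1-S)x):x\in E\}$. For $I\subset\{1,\dots,n\}$ with complement $I^c$ put $\Lambda_I=\mathrm{span}_{\mathbb C}\{\mathbf e_i,\mathbf f_j:i\in I,\ j\in I^c\}$. Fix reals $0<\alpha_1<\cdots<\alpha_n$, let $\widehat A\mathbf e_i=\alpha_i\mathbf e_i$, $\widehat A\mathbf f_i=-\alpha_i\mathbf f_i$, $\Psi^t(L)=e^{t\widehat A}L$, and $W_I^\pm=\{L\in\mathrm{Lag}_h(\widehat E):\lim_{t\to\infty}e^{\pm t\widehat A}L=\Lambda_I\}$. The flow $\Psi^t$ is the positive gradient flow of the Morse function $\varphi(L)=\mathrm{Re}\,\mathrm{tr}(\widehat AP_L)$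 ($P_L$ the orthogonal projection onto $L$) with respect to the metric on $\mathrm{Lag}_h(\widehat E)$ transported from the metric on $U(E)$ induced by $\langle X,Y\rangle=\mathrm{Re}\,\mathrm{tr}(XY^* )$ on $\mathrm{End}_{\mathbb C}(E)$; its stationary points are the $\Lambda_I$, and $W_I^\pm$ are their stable/unstable manifolds. *)

(* Defs.v *)
From HB Require Import structures.
From mathcomp Require Import all_boot all_order all_algebra.
From mathcomp Require Import all_classical all_reals all_analysis.
From mathcomp Require Import complex.

Set Implicit Arguments.
Unset Strict Implicit.
Unset Printing Implicit Defensive.
Import Order.TTheory GRing.Theory Num.Theory.
Import numFieldNormedType.Exports.

Local Open Scope classical_set_scope.
Local Open Scope ring_scope.

Section OrthogonalProjection.

(* [cj] is the involution of the scalar product: [idfun] for the Euclidean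
   space R^m, complex conjugation for the Hermitian space C^m. *)
Variables (K : fieldType) (cj : K -> K) (m : nat).
Implicit Types (u v : 'cV[K]_m) (L : {vspace 'cV[K]_m}).

Definition scalprod u v : K := \sum_i u i 0 * cj (v i 0).

Definition orthv L : {vspace 'cV[K]_m} :=
  (\bigcap_(v <- vbasis L) lker (linfun (fun u => scalprod u v : K^o)))%VS.

Definition orthproj L : 'M[K]_m :=
  \matrix_(i, j) daddv_pi L (orthv L) (delta_mx j 0) i 0.

End OrthogonalProjection.

Section Submanifolds.

Variable R : realType.

(* On an open set of a finite-dimensional space, C^k amounts to the existence
   and continuity of all iterated directional derivatives up to order k. *)
Fixpoint Ck (U V : normedModType R) (k : nat) (D : set U) (f : U -> V) : Prop :=
  match k with
  | 0 => forall x, D x -> {for x, continuous f}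
  | k'.+1 => (forall x v, D x -> derivable f x v) /\
             (forall v, Ck k' D ('D_v f))
  end.

Definition smooth_on (U V : normedModType R) (D : set U) (f : U -> V) : Prop :=
  forall k, Ck k D f.

Variable N : nat.
Implicit Types (M X Y S : set 'cV[R]_N) (p v : 'cV[R]_N).

(* Embedded submanifolds of R^N without boundary: near each of its points, [M]
   is diffeomorphic to an open subset of R^d, where a map defined on a part of
   R^N is smooth when it extends to a smooth map on an open set. *)
Definition submanifold (d : nat) M : Prop :=
  forall p, M p ->
  exists (U : set 'cV[R]_d) (O : set 'cV[R]_N)
         (phi : 'cV[R]_d -> 'cV[R]_N) (rho : 'cV[R]_N -> 'cV[R]_d),
    [/\ open U, open O & O p] /\
    [/\ smooth_on U phi, smooth_on O rho,
        phi @` U = M `&` O & forall u, U u -> rho (phi u) = u].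

Definition tangent_vector M p v : Prop :=
  exists (e : R) (gamma : R^o -> 'cV[R]_N),
    [/\ 0 < e, smooth_on [set t : R^o | `|t| < e] gamma,
        forall t : R, `|t| < e -> M (gamma t),
        gamma 0 = p & derive1 gamma 0 = v].

Definition tangent_space M p (T : {vspace 'cV[R]_N}) : Prop :=
  forall v, v \in T <-> tangent_vector M p v.

Definition transverse M X Y : Prop :=
  [/\ exists d, submanifold d M, exists d, submanifold d X,
      exists d, submanifold d Y, X `<=` M & Y `<=` M] /\
  forall p, X p -> Y p -> forall v,
    tangent_vector M p v <->
    exists a b, [/\ tangent_vector X p a, tangent_vector Y p b & v = a + b].

(* Convergence in the Grassmannian of linear subspaces of R^N. *)
Definition grass_cvg (T : nat -> {vspace 'cV[R]_N}) (tau : {vspace 'cV[R]_N}) :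
    Prop :=
  orthproj idfun (T k) @[k --> \oo] --> orthproj idfun tau.

Definition whitney_a X Y : Prop :=
  forall (y : 'cV[R]_N) (x : nat -> 'cV[R]_N) T tau,
    Y y -> (forall k, X (x k)) -> x @ \oo --> y ->
    (forall k, tangent_space X (x k) (T k)) -> grass_cvg T tau ->
    forall v, tangent_vector Y y v -> v \in tau.

Definition whitney_b X Y : Prop :=
  forall (y : 'cV[R]_N) (x z : nat -> 'cV[R]_N) T tau l,
    Y y -> (forall k, X (x k)) -> (forall k, Y (z k)) ->
    (forall k, x k != z k) -> x @ \oo --> y -> z @ \oo --> y ->
    (forall k, tangent_space X (x k) (T k)) -> grass_cvg T tau ->
    grass_cvg (fun k => <[x k - z k]>%VS) l ->
    (l <= tau)%VS.

(* The condition on dimensions says that the unions of the strata of dimension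
   at most k are closed in [M], i.e., that they form a filtration of [M]. *)
Definition whitney_stratification (I : finType) (S : I -> set 'cV[R]_N) M :
    Prop :=
  exists d : I -> nat,
  [/\ M = \bigcup_i S i,
      trivIset setT S,
      forall i, [/\ S i !=set0, connected (S i) & submanifold (d i) (S i)],
      forall i j, i != j -> S i `&` closure (S j) !=set0 ->
        S i `<=` closure (S j) /\ (d i < d j)%N
    & forall i j, i != j -> S i `<=` closure (S j) ->
        whitney_a (S j) (S i) /\ whitney_b (S j) (S i)].

End Submanifolds.

Section HermitianLagrangians.

Variables (R : realType) (n : nat).
Local Notation C := R[i].

(* E is C^n with its standard basis, and (x, y) in E + E is [col_mx x y]. *)
Definition ebf (i : 'I_n) : 'cV[C]_(n + n) := col_mx (delta_mx i 0) 0.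
Definition fbf (i : 'I_n) : 'cV[C]_(n + n) := col_mx 0 (delta_mx i 0).

Definition Jhat (v : 'cV[C]_(n + n)) : 'cV[C]_(n + n) :=
  col_mx (- dsubmx v) (usubmx v).

Definition Lag_h : set {vspace 'cV[C]_(n + n)} :=
  [set L | orthv (@conjc R) L = (linfun Jhat @: L)%VS].

Definition Lambda (I : {set 'I_n}) : {vspace 'cV[C]_(n + n)} :=
  (\sum_(i in I) <[ebf i]> + \sum_(j in ~: I) <[fbf j]>)%VS.

(* The embedding L |-> P_L of the Grassmannian in the space of complex
   matrices, with the latter seen as a real coordinate space. *)
Definition realify m (P : 'M[C]_m) : 'cV[R]_(m * m + m * m) :=
  col_mx (mxvec (map_mx (@complex.Re R) P))^T
         (mxvec (map_mx (@complex.Im R) P))^T.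

Definition emb (L : {vspace 'cV[C]_(n + n)}) :=
  realify (orthproj (@conjc R) L).

Definition expmx m (A : 'M[R]_m) : 'M[R]_m :=
  \matrix_(i, j) limn (series (fun k => (A ^+ k) i j / k`!%:R)).

Variable alpha : 'I_n -> R.

Definition Ahat : 'M[R]_(n + n) :=
  diag_mx (row_mx (\row_i alpha i) (\row_i - alpha i)).

Definition Psi (t : R) (L : {vspace 'cV[C]_(n + n)}) :
    {vspace 'cV[C]_(n + n)} :=
  (linfun (mulmx (map_mx (real_complex R) (expmx (t *: Ahat)))) @: L)%VS.

Definition Wplus (I : {set 'I_n}) : set {vspace 'cV[C]_(n + n)} :=
  [set L | Lag_h L /\ emb (Psi t L) @[t --> +oo] --> emb (Lambda I)].

Definition Wminus (I : {set 'I_n}) : set {vspace 'cV[C]_(n + n)} :=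
  [set L | Lag_h L /\ emb (Psi (- t) L) @[t --> +oo] --> emb (Lambda I)].

End HermitianLagrangians.

(* Main.v *)
From HB Require Import structures.
Require Import Defs.
From mathcomp Require Import all_boot all_order all_algebra.
From mathcomp Require Import all_classical all_reals all_analysis.
From mathcomp Require Import complex lra.
Import Order.TTheory GRing.Theory Num.Theory.
Import numFieldNormedType.Exports.
Local Open Scope classical_set_scope.
Local Open Scope ring_scope.

Set Implicit Arguments.
Unset Strict Implicit.
Unset Printing Implicit Defensive.

(* The cells have a simple form in the chart around [Lambda I] that describes a
   Lagrangian as the graph of a Hermitian matrix [T]. The flow multiplies the
   entry [T i j] by an exponential whose rate has the sign determined by whether
   [max i j] is in [I], so that [Wminus I] and [Wplus I] are, in this chart,
   complementary coordinate subspaces V- and V+. Moreover, every [Wminus K] is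
   invariant under the translations by V- (they come from shears that the flow
   contracts to the identity) and under the dilations [T |-> c T] with [0 < c]
   (they come from a torus that commutes with the flow). Hence, in the chart, the
   tangent space of [Wminus K] at [x] contains V- and [x], so that it contains
   the secant [x - z] for every [z] in [Wminus I]: both Whitney conditions follow,
   since the chart is C^1. The frontier condition comes from the translations,
   the inequality between dimensions from the line spanned by [x], and the
   transversality from the inclusion of V- in the tangent spaces of [Wminus K]. *)

(** * Spans of columns and orthogonal projections *)

(** Lagrangians are embedded by their orthogonal projections, and the projection onto the span of an
    injective frame [F] is [F (F* F)^-1 F*], a rational function of [F] and its conjugate whose
    denominator has no zero. Smoothness to all orders therefore comes from a single class of
    rational functions that is stable under directional derivatives. The second Whitney condition
    compares secants with tangent spaces, so that derivatives at one point do not suffice: two-point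
    quotients with [f x - f y = G x y (x - y)] are carried through the chart, and their continuity
    at the diagonal plays the part of the mean value theorem. A whole cell lies in one chart because
    the chart domain is invariant under the flow and is entered by every trajectory that converges
    to its centre. The rate of [T i j] is a sum of two eigenvalues of [Ahat] up to sign; strict
    monotonicity of [alpha] forbids cancellation, so that each coordinate either contracts or
    expands. That every Lagrangian lies in a cell is proved by linear algebra, without a convergence
    theorem for gradient trajectories. *)

Section ColumnSpan.
Variable K : fieldType.

Definition colspan m k (F : 'M[K]_(m, k)) : {vspace 'cV[K]_m} :=
  limg (linfun (mulmx F : 'cV[K]_k -> 'cV[K]_m)).

Definition injmx m k (F : 'M[K]_(m, k)) := forall x : 'cV[K]_k, F *m x = 0 -> x = 0.

Lemma colspanP m k (F : 'M[K]_(m, k)) v :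
  reflect (exists x, v = F *m x) (v \in colspan F).
Proof.
apply: (iffP memv_imgP) => [[x _ ->]|[x ->]]; first by exists x; rewrite lfunE.
by exists x; rewrite ?memvf// lfunE.
Qed.

Lemma colspan_mulr m k (F : 'M[K]_(m, k)) (G : 'M[K]_k) :
  G \in unitmx -> colspan (F *m G) = colspan F.
Proof.
move=> Gu; apply/vspaceP => v; apply/colspanP/colspanP => -[x ->].
  by exists (G *m x); rewrite mulmxA.
by exists (invmx G *m x); rewrite !mulmxA mulmxK.
Qed.

Lemma dim_colspan m k (F : 'M[K]_(m, k)) : injmx F -> \dim (colspan F) = k.
Proof.
move=> Fi; rewrite /colspan limg_dim_eq ?dimvf//=; first by rewrite /dim/= muln1.
apply/eqP; rewrite -subv0; apply/subvP => x; rewrite memv_cap memv_ker lfunE/=.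
by move=> /andP[_ /eqP/Fi ->]; rewrite mem0v.
Qed.

Lemma colspan_limg m p k (A : 'M[K]_(p, m)) (F : 'M[K]_(m, k)) :
  (linfun (mulmx A : 'cV[K]_m -> 'cV[K]_p) @: colspan F)%VS = colspan (A *m F).
Proof.
apply/vspaceP => v; apply/memv_imgP/colspanP => [[u /colspanP[x ->] ->]|[x ->]].
  by exists x; rewrite lfunE/= mulmxA.
exists (F *m x); first by apply/colspanP; exists x.
by rewrite lfunE/= mulmxA.
Qed.

Lemma colspan_exists m k (L : {vspace 'cV[K]_m}) : \dim L = k ->
  exists2 F : 'M[K]_(m, k), injmx F & L = colspan F.
Proof.
move=> <-; pose F : 'M[K]_(m, \dim L) := \matrix_(i, j) (vbasis L)`_j i 0.
have FE x : F *m x = \sum_j x j 0 *: (vbasis L)`_j.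
  apply/matrixP => i j; rewrite ord1 !mxE summxE; apply: eq_bigr => l _.
  by rewrite !mxE mulrC.
exists F.
  have /freeP fr := basis_free (vbasisP L).
  move=> x; rewrite FE => /fr x0.
  by apply/matrixP => i j; rewrite ord1 mxE x0.
apply/vspaceP => v; apply/idP/colspanP => [vL|[x ->]]; last first.
  rewrite FE; apply: memv_suml => i _; apply: memvZ; apply: vbasis_mem.
  by apply: mem_nth; rewrite size_tuple.
exists (\col_i coord (vbasis L) i v); rewrite FE {1}(coord_vbasis vL).
by apply: eq_bigr => i _; rewrite mxE.
Qed.

End ColumnSpan.

Section OrthogonalProjectionTheory.
Variables (K : fieldType) (cj : {rmorphism K -> K}).
Hypothesis cjK : involutive cj.
Hypothesis cj_definite : forall m (u : 'cV[K]_m), scalprod cj u u = 0 -> u = 0.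

Definition adjmx m k (A : 'M[K]_(m, k)) : 'M[K]_(k, m) := (map_mx cj A)^T.

Lemma adjmxE m k (A : 'M[K]_(m, k)) i j : adjmx A i j = cj (A j i).
Proof. by rewrite !mxE. Qed.

Lemma adjmxK m k (A : 'M[K]_(m, k)) : adjmx (adjmx A) = A.
Proof. by apply/matrixP => i j; rewrite !adjmxE cjK. Qed.

Lemma adjmxM m k l (A : 'M[K]_(m, k)) (B : 'M[K]_(k, l)) :
  adjmx (A *m B) = adjmx B *m adjmx A.
Proof. by rewrite /adjmx map_mxM trmx_mul. Qed.

Lemma adjmxN m k (A : 'M[K]_(m, k)) : adjmx (- A) = - adjmx A.
Proof. by rewrite /adjmx map_mxN linearN. Qed.

Lemma adjmx1 m : adjmx (1%:M : 'M[K]_m) = 1%:M.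
Proof. by rewrite /adjmx map_mx1 trmx1. Qed.

Lemma adjmx0 m k : adjmx (0 : 'M[K]_(m, k)) = 0.
Proof. by apply/matrixP => i j; rewrite adjmxE !mxE rmorph0. Qed.

(** Applied with [G] the Gram matrix of a frame: it makes membership in a chart readable from the
    projection alone. *)
Lemma unitmx_congr k (X G : 'M[K]_k) : G \in unitmx ->
  (X *m invmx G *m adjmx X \in unitmx) = (X \in unitmx).
Proof.
by move=> Gu; rewrite !unitmx_mul unitmx_inv Gu andbT /adjmx unitmx_tr map_unitmx andbb.
Qed.

Lemma scalprodE m (u v : 'cV[K]_m) : scalprod cj u v = (adjmx v *m u) 0 0.
Proof.
by rewrite /scalprod mxE; apply: eq_bigr => i _; rewrite adjmxE mulrC.
Qed.

Lemma scalprod_linear m (v : 'cV[K]_m) :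
  linear (fun u => scalprod cj u v : K^o).
Proof. by move=> a x y; rewrite !scalprodE mulmxDr -scalemxAr !mxE. Qed.

Lemma orthvP m (L : {vspace 'cV[K]_m}) w :
  reflect (forall v, v \in L -> scalprod cj w v = 0) (w \in orthv cj L).
Proof.
have lE (v u : 'cV[K]_m) : linfun (fun u => scalprod cj u v : K^o) u = scalprod cj u v.
  pose f : {linear 'cV[K]_m -> K^o} := HB.pack (fun u => scalprod cj u v : K^o)
    (GRing.isLinear.Build _ _ _ _ _ (@scalprod_linear m v)).
  exact: (lfunE f u).
have -> : (w \in orthv cj L) = all (fun v => scalprod cj w v == 0) (vbasis L).
  rewrite /orthv; elim: (tval (vbasis L)) => [|v s IHs] /=.
    by rewrite big_nil memvf.
  by rewrite big_cons memv_cap memv_ker lE IHs.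
apply: (iffP allP) => [wL v vL|wL v /vbasis_mem vL]; last by rewrite wL.
rewrite (coord_vbasis vL) scalprodE /adjmx map_mx_sum linear_sum/= mulmx_suml.
rewrite summxE big1// => i _; rewrite map_mxZ linearZ/= -scalemxAl mxE.
have /wL/eqP : (vbasis L)`_i \in vbasis L by rewrite mem_nth ?size_tuple.
by rewrite scalprodE => ->; rewrite mulr0.
Qed.

Lemma adjmx_mul_injmx m k (F : 'M[K]_(m, k)) :
  injmx F -> adjmx F *m F \in unitmx.
Proof.
move=> Fi; rewrite -row_free_unit -kermx_eq0; apply/rowV0P => x /sub_kermxP.
move=> /(congr1 (fun u => adjmx u)); rewrite !adjmxM adjmxK.
rewrite adjmx0 => x0.
have /Fi y0 : F *m adjmx x = 0.
  apply: cj_definite; rewrite scalprodE adjmxM adjmxK -mulmxA (mulmxA (adjmx F)) x0 mulmx0.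
  by rewrite mxE.
by rewrite -[x]adjmxK y0 adjmx0.
Qed.

Lemma orthv_colspan m k (F : 'M[K]_(m, k)) w :
  (w \in orthv cj (colspan F)) = (adjmx F *m w == 0).
Proof.
apply/orthvP/eqP => [wF|wF v /colspanP[x ->]]; last first.
  by rewrite scalprodE adjmxM -mulmxA wF mulmx0 mxE.
apply/matrixP => i j; rewrite ord1 [RHS]mxE.
rewrite -(wF (F *m delta_mx i 0)); last by apply/colspanP; exists (delta_mx i 0).
rewrite scalprodE adjmxM -mulmxA [RHS]mxE (bigD1 i)//= big1 => [|l li].
  by rewrite addr0 !mxE !eqxx rmorph1 mul1r.
by rewrite !mxE (negPf li) rmorph0 mul0r.
Qed.

Lemma orthv_cap m (L : {vspace 'cV[K]_m}) : (L :&: orthv cj L)%VS = 0%VS.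
Proof.
apply/eqP; rewrite -subv0; apply/subvP => v; rewrite memv_cap memv0.
by case/andP => vL /orthvP/(_ _ vL)/cj_definite ->.
Qed.

Lemma orthproj_mul m (L : {vspace 'cV[K]_m}) v :
  orthproj cj L *m v = daddv_pi L (orthv cj L) v.
Proof.
have vE : v = \sum_j v j 0 *: delta_mx j 0.
  rewrite {1}[v]matrix_sum_delta; apply: eq_bigr => i _.
  by rewrite big_ord1.
rewrite {2}vE linear_sum/=; apply/matrixP => i j.
rewrite ord1 mxE summxE; apply: eq_bigr => l _.
by rewrite linearZ/= !mxE mulrC.
Qed.

Lemma orthproj_mem m (L : {vspace 'cV[K]_m}) v : orthproj cj L *m v \in L.
Proof. by rewrite orthproj_mul memv_pi. Qed.

Lemma orthproj_id m (L : {vspace 'cV[K]_m}) v :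
  v \in L -> orthproj cj L *m v = v.
Proof. by move=> vL; rewrite orthproj_mul daddv_pi_id// orthv_cap. Qed.

Lemma orthproj_inj m (L L' : {vspace 'cV[K]_m}) :
  orthproj cj L = orthproj cj L' -> L = L'.
Proof.
move=> E; apply/vspaceP => v; apply/idP/idP => /orthproj_id vE.
  by rewrite -vE E orthproj_mem.
by rewrite -vE -E orthproj_mem.
Qed.

(** This closed formula is what makes the projection a rational function of the frame. *)
Lemma orthproj_colspan m k (F : 'M[K]_(m, k)) : injmx F ->
  orthproj cj (colspan F) = F *m invmx (adjmx F *m F) *m adjmx F.
Proof.
move=> /adjmx_mul_injmx Fu; set P := RHS.
have Pmem v : P *m v \in colspan F.
  apply/colspanP; exists (invmx (adjmx F *m F) *m adjmx F *m v).
  by rewrite !mulmxA.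
have Port v : v - P *m v \in orthv cj (colspan F).
  by rewrite orthv_colspan mulmxBr !mulmxA mulmxV// mul1mx subrr.
suff PE (v : 'cV[K]_m) : orthproj cj (colspan F) *m v = P *m v.
  apply/matrixP => i j; have := congr1 (fun u : 'cV_m => u i 0) (PE (delta_mx j 0)).
  by rewrite -!colE !mxE.
have := Port v; set w := v - _ => wO.
have -> : orthproj cj (colspan F) *m v = orthproj cj (colspan F) *m w + P *m v.
  by rewrite mulmxBr (orthproj_id (Pmem v)) subrK.
rewrite (_ : _ *m w = 0) ?add0r// orthproj_mul.
have wD : w \in (colspan F + orthv cj (colspan F))%VS.
  by rewrite -[w]add0r memv_add ?mem0v.
have := daddv_pi_add (orthv_cap (colspan F)) wD.
(* The components of [w] along the two summands add up to [w]; the second one is already [w], hence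
   the first vanishes. *)
rewrite (@daddv_pi_id _ _ (orthv cj (colspan F)))// 1?capvC ?orthv_cap// => /eqP.
by rewrite -[X in _ == X]add0r (inj_eq (addIr _)) => /eqP.
Qed.

Lemma dim_orthv m (L : {vspace 'cV[K]_m}) : (\dim L + \dim (orthv cj L))%N = m.
Proof.
rewrite -dimv_disjoint_sum ?orthv_cap//.
have [F Fi LF] := colspan_exists (erefl (\dim L)).
have -> : (L + orthv cj L)%VS = fullv.
  apply/vspaceP => v; rewrite memvf -[v](subrKC (orthproj cj L *m v)).
  rewrite memv_add ?orthproj_mem// LF orthproj_colspan// orthv_colspan mulmxBr !mulmxA.
  by rewrite mulmxV ?adjmx_mul_injmx// mul1mx subrr.
by rewrite dimvf /dim/= muln1.
Qed.

End OrthogonalProjectionTheory.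

(** * Matrices over an algebra of functions *)

Section FunctionAlgebra.
Variables (R : realType) (T : Type).
Local Notation C := R[i].

(* [Nz] is the condition under which [A] is stable by inversion. Two instances
   are used: the rational functions on a set, with [Nz] the absence of zeros, and
   the functions that converge to their value at a point along a filter. *)
Record funalg (A Nz : (T -> R) -> Prop) : Prop := Funalg {
  funalg_cst : forall c, A (fun=> c);
  funalgD : forall f g, A f -> A g -> A (fun x => f x + g x);
  funalgM : forall f g, A f -> A g -> A (fun x => f x * g x);
  funalgV : forall f, A f -> Nz f -> A (fun x => (f x)^-1) }.

Variables (A Nz : (T -> R) -> Prop).
Hypothesis AP : funalg A Nz.

Lemma funalgN f : A f -> A (fun x => - f x).
Proof.
move=> Af; rewrite (_ : (fun x : T => _) = fun x => (-1) * f x).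
  by apply: (funalgM AP) => //; exact: (funalg_cst AP).
by apply/funext => x; rewrite mulN1r.
Qed.

Lemma funalg_sum (I : Type) (r : seq I) (P : pred I) (f : I -> T -> R) :
  (forall i, A (f i)) -> A (fun x => \sum_(i <- r | P i) f i x).
Proof.
move=> Af; elim: r => [|i r IHr].
  rewrite (_ : (fun x : T => _) = fun=> 0); first exact: (funalg_cst AP).
  by apply/funext => x; rewrite big_nil.
rewrite (_ : (fun x : T => _) = fun x => (if P i then f i x else 0) +
   \sum_(i <- r | P i) f i x).
  by apply: (funalgD AP) => //; case: (P i) => //; exact: (funalg_cst AP).
by apply/funext => x; rewrite big_cons; case: ifP => //; rewrite add0r.
Qed.

Definition calg (f : T -> C) :=
  A (fun x => complex.Re (f x)) /\ A (fun x => complex.Im (f x)).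

Definition mxalg m k (F : T -> 'M[C]_(m, k)) := forall i j, calg (fun x => F x i j).

(** The squared modulus turns the absence of zeros of a complex function into a condition on a real
    function, which is the form that [Nz] accepts. *)
Definition cnorm2 (z : C) : R := complex.Re z ^+ 2 + complex.Im z ^+ 2.

Lemma calg_cst c : calg (fun=> c).
Proof. by split; exact: (funalg_cst AP). Qed.

Lemma calgD f g : calg f -> calg g -> calg (fun x => f x + g x).
Proof.
move=> [f1 f2] [g1 g2]; split.
  rewrite (_ : (fun x : T => _) = fun x => complex.Re (f x) + complex.Re (g x)).
    exact: (funalgD AP).
  by apply/funext => x; case: (f x) => a b; case: (g x).
rewrite (_ : (fun x : T => _) = fun x => complex.Im (f x) + complex.Im (g x)).
  exact: (funalgD AP).
by apply/funext => x; case: (f x) => a b; case: (g x).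
Qed.

Lemma calgM f g : calg f -> calg g -> calg (fun x => f x * g x).
Proof.
move=> [f1 f2] [g1 g2]; split.
  rewrite (_ : (fun x : T => _) = fun x => complex.Re (f x) * complex.Re (g x)
    + - (complex.Im (f x) * complex.Im (g x))).
    by apply: (funalgD AP); [|apply: funalgN]; exact: (funalgM AP).
  by apply/funext => x; case: (f x) => a b; case: (g x).
rewrite (_ : (fun x : T => _) = fun x => complex.Re (f x) * complex.Im (g x)
    + complex.Im (f x) * complex.Re (g x)).
  by apply: (funalgD AP); exact: (funalgM AP).
by apply/funext => x; case: (f x) => a b; case: (g x).
Qed.

Lemma calg_conj f : calg f -> calg (fun x => conjc (f x)).
Proof.
move=> [f1 f2]; split.
  by rewrite (_ : (fun x : T => _) = fun x => complex.Re (f x))//; apply/funext => x; case: (f x).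
rewrite (_ : (fun x : T => _) = fun x => - complex.Im (f x)); first exact: funalgN.
by apply/funext => x; case: (f x).
Qed.

Lemma calg_real (f : T -> R) : A f -> calg (fun x => (f x)%:C%C).
Proof. by move=> Af; split => //; exact: (funalg_cst AP). Qed.

Lemma calgV f : calg f -> Nz (fun x => cnorm2 (f x)) -> calg (fun x => (f x)^-1).
Proof.
move=> [f1 f2] nz.
have nA : A (fun x => (cnorm2 (f x))^-1).
  apply: (funalgV AP) => //.
  by apply: (funalgD AP); exact: (funalgM AP).
rewrite (_ : (fun x : T => _) = fun x => conjc (f x) * ((cnorm2 (f x))^-1)%:C%C).
  by apply: calgM; [exact: calg_conj|exact: calg_real].
apply/funext => x; case: (f x) => a b; rewrite /cnorm2 /=.
by apply/eqP; rewrite eq_complex/= !mulr0 subr0 add0r mulNr !eqxx.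
Qed.

Lemma calg_sum (I : Type) (r : seq I) (P : pred I) (f : I -> T -> C) :
  (forall i, calg (f i)) -> calg (fun x => \sum_(i <- r | P i) f i x).
Proof.
move=> Af; elim: r => [|i r IHr].
  rewrite (_ : (fun x : T => _) = fun=> 0); first exact: calg_cst.
  by apply/funext => x; rewrite big_nil.
rewrite (_ : (fun x : T => _) = fun x => (if P i then f i x else 0) +
   \sum_(i <- r | P i) f i x).
  by apply: calgD => //; case: (P i) => //; exact: calg_cst.
by apply/funext => x; rewrite big_cons; case: ifP => //; rewrite add0r.
Qed.

Lemma calg_prod (I : Type) (r : seq I) (f : I -> T -> C) :
  (forall i, calg (f i)) -> calg (fun x => \prod_(i <- r) f i x).
Proof.
move=> Af; elim: r => [|i r IHr].
  rewrite (_ : (fun x : T => _) = fun=> 1); first exact: calg_cst.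
  by apply/funext => x; rewrite big_nil.
rewrite (_ : (fun x : T => _) = fun x => f i x * \prod_(i <- r) f i x).
  exact: calgM.
by apply/funext => x; rewrite big_cons.
Qed.

Lemma mxalg_cst m k (B : 'M[C]_(m, k)) : mxalg (fun=> B).
Proof. by move=> i j; exact: calg_cst. Qed.

Lemma mxalgD m k (F G : T -> 'M[C]_(m, k)) :
  mxalg F -> mxalg G -> mxalg (fun x => F x + G x).
Proof.
move=> FA GA i j; rewrite (_ : (fun x : T => _) = fun x => F x i j + G x i j).
  exact: calgD.
by apply/funext => x; rewrite mxE.
Qed.

Lemma mxalgM m k l (F : T -> 'M[C]_(m, k)) (G : T -> 'M[C]_(k, l)) :
  mxalg F -> mxalg G -> mxalg (fun x => F x *m G x).
Proof.
move=> FA GA i j; rewrite (_ : (fun x : T => _) = fun x => \sum_l F x i l * G x l j).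
  by apply: calg_sum => p; exact: calgM.
by apply/funext => x; rewrite mxE.
Qed.

Lemma mxalg_adj m k (F : T -> 'M[C]_(m, k)) :
  mxalg F -> mxalg (fun x => adjmx (@conjc R) (F x)).
Proof.
move=> FA i j; rewrite (_ : (fun x : T => _) = fun x => conjc (F x j i)).
  exact: calg_conj.
by apply/funext => x; rewrite adjmxE.
Qed.

Lemma calg_det k (F : T -> 'M[C]_k) : mxalg F -> calg (fun x => \det (F x)).
Proof.
move=> FA; apply: calg_sum => s; apply: calgM; first exact: calg_cst.
by apply: calg_prod => i; exact: FA.
Qed.

(* It coincides with [invmx] on units, but is a rational function everywhere. *)
Definition detinv k (M : 'M[C]_k) := (\det M)^-1 *: \adj M.

Lemma mxalg_detinv k (F : T -> 'M[C]_k) : mxalg F ->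
  Nz (fun x => cnorm2 (\det (F x))) -> mxalg (fun x => detinv (F x)).
Proof.
move=> FA nz i j.
rewrite (_ : (fun x : T => _) = fun x => (\det (F x))^-1 * cofactor (F x) j i).
  apply: calgM; first by apply: calgV => //; exact: calg_det.
  apply: calgM; first exact: calg_cst.
  apply: calg_det => a b.
  rewrite (_ : (fun x : T => _) = fun x => F x (lift j a) (lift i b)); first exact: FA.
  by apply/funext => x; rewrite !mxE.
by apply/funext => x; rewrite !mxE.
Qed.

End FunctionAlgebra.

(** * Complex matrices in real coordinates, and the projection onto the span of a frame *)

Section ComplexMatrices.
Variable R : realType.
Local Notation C := R[i].
Local Notation adj := (adjmx (@conjc R)).

Lemma detinvE k (M : 'M[C]_k) : M \in unitmx -> detinv M = invmx M.
Proof. by rewrite /invmx /detinv => ->. Qed.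

Lemma cnorm2_eq0 (z : C) : (cnorm2 z == 0) = (z == 0).
Proof.
by case: z => a b; rewrite /cnorm2/= paddr_eq0 ?sqr_ge0// !sqrf_eq0 eq_complex.
Qed.

Lemma complex_definite m (u : 'cV[C]_m) : scalprod (@conjc R) u u = 0 -> u = 0.
Proof.
rewrite /scalprod => u0.
have {}u0 : \sum_i cnorm2 (u i 0) = 0.
  transitivity (complex.Re (\sum_i u i 0 * conjc (u i 0))); last by rewrite u0.
  rewrite (raddf_sum (@complex.Re R : {additive Rcomplex R -> R}))/=.
  apply: eq_bigr => i _; case: (u i 0) => a b.
  by rewrite /cnorm2/= mulrN opprK !expr2.
apply/matrixP => i j; rewrite ord1 mxE; apply/eqP; rewrite -cnorm2_eq0.
have /psumr_eq0P -> // : forall i, true -> 0 <= cnorm2 (u i 0).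
by move=> l _; rewrite addr_ge0 ?sqr_ge0.
Qed.

Lemma real_definite m (u : 'cV[R]_m) : scalprod idfun u u = 0 -> u = 0.
Proof.
rewrite /scalprod => u0; apply/matrixP => i j; rewrite ord1 mxE; apply/eqP.
rewrite -sqrf_eq0 expr2.
have /psumr_eq0P : forall i, true -> 0 <= u i 0 * idfun (u i 0).
  by move=> l _; rewrite -expr2 sqr_ge0.
by move=> /(_ u0 i isT) ->.
Qed.

Definition frameproj m k (F : 'M[C]_(m, k)) : 'M[C]_m :=
  F *m detinv (adj F *m F) *m adj F.

Lemma frameprojE m k (F : 'M[C]_(m, k)) : injmx F ->
  orthproj (@conjc R) (colspan F) = frameproj F.
Proof.
move=> Fi; rewrite (orthproj_colspan (@conjcK R) complex_definite)//.
by rewrite /frameproj detinvE// (adjmx_mul_injmx (@conjcK R) complex_definite).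
Qed.

Definition unrealify m (v : 'cV[R]_(m * m + m * m)) : 'M[C]_m :=
  \matrix_(i, j) (v (lshift _ (mxvec_index i j)) 0 +i* v (rshift _ (mxvec_index i j)) 0)%C.

Lemma realify_l m (P : 'M[C]_m) i j :
  realify P (lshift _ (mxvec_index i j)) 0 = complex.Re (P i j).
Proof. by rewrite /realify col_mxEu mxE mxvecE mxE. Qed.

Lemma realify_r m (P : 'M[C]_m) i j :
  realify P (rshift _ (mxvec_index i j)) 0 = complex.Im (P i j).
Proof. by rewrite /realify col_mxEd mxE mxvecE mxE. Qed.

Lemma realifyK m : cancel (@realify R m) (@unrealify m).
Proof.
move=> P; apply/matrixP => i j; rewrite mxE realify_l realify_r.
by case: (P i j).
Qed.

Lemma realify_alg (T : Type) (A : (T -> R) -> Prop) m (F : T -> 'M[C]_m) :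
  mxalg A F -> forall i, A (fun x => realify (F x) i 0).
Proof.
move=> FA i; case: (split_ordP i) => k ->; case/mxvec_indexP: k => a b.
  rewrite (_ : (fun x : T => _) = fun x => complex.Re (F x a b)); first exact: (FA a b).1.
  by apply/funext => x; rewrite realify_l.
rewrite (_ : (fun x : T => _) = fun x => complex.Im (F x a b)); first exact: (FA a b).2.
by apply/funext => x; rewrite realify_r.
Qed.

Lemma unrealify_alg (T : Type) (A : (T -> R) -> Prop) m
    (f : T -> 'cV[R]_(m * m + m * m)) :
  (forall i, A (fun x => f x i 0)) -> mxalg A (fun x => unrealify (f x)).
Proof.
move=> fA a b; split.
  rewrite (_ : (fun x : T => _) = fun x => f x (lshift _ (mxvec_index a b)) 0) => //.
  by apply/funext => x; rewrite mxE.
rewrite (_ : (fun x : T => _) = fun x => f x (rshift _ (mxvec_index a b)) 0) => //.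
by apply/funext => x; rewrite mxE.
Qed.

End ComplexMatrices.

(** * Rational functions are smooth *)

Section MatrixLimits.
Variable R : realType.

Lemma cvg_mxP (T : Type) (F : set_system T) {FF : Filter F} m k
    (f : T -> 'M[R]_(m, k)) (l : 'M[R]_(m, k)) :
  f @ F --> l <-> forall i j, f x i j @[x --> F] --> l i j.
Proof.
split=> [fl i j|fl].
  exact: (cvg_comp _ _ fl (@coord_continuous _ _ _ i j l)).
apply/cvgrPdist_le => e e0; near=> x.
rewrite /Num.Def.normr/= mx_normrE (bigmax_le _ (ltW e0))//= => i _.
rewrite !mxE/=; move: i; near: x; apply: filter_forall => /= i.
exact: ((cvgrPdist_le _ _).1 (fl i.1 i.2)).
Unshelve. all: by end_near. Qed.

Lemma cvg_funalg (T : Type) (F : set_system T) {FF : Filter F} (x0 : T) :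
  funalg (fun f : T -> R => f @ F --> f x0) (fun f => f x0 != 0).
Proof.
split=> [c|f g fx gx|f g fx gx|f fx f0]; first exact: cvg_cst.
- exact: (@cvgD _ R^o).
- exact: (@cvgM R).
- exact: (@cvgV R).
Qed.

End MatrixLimits.

Section RationalFunctions.
Variable R : realType.

(** Stability under directional derivatives gives all orders of [smooth_on] by one induction. The
    rule [rat_ext] is there because the formulas for derivatives hold on [D] only, and [rat_lin]
    asks for continuity since [U] is an arbitrary normed module. *)
Inductive ratfun (U : normedModType R) (D : set U) : (U -> R) -> Prop :=
| rat_lin (l : {linear U -> R^o}) : continuous l -> ratfun D l
| rat_cst c : ratfun D (fun=> c)
| ratD f g : ratfun D f -> ratfun D g -> ratfun D (fun x => f x + g x)
| ratM f g : ratfun D f -> ratfun D g -> ratfun D (fun x => f x * g x)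
| ratV f : ratfun D f -> (forall x, D x -> f x != 0) -> ratfun D (fun x => (f x)^-1)
| rat_ext f g : ratfun D f -> (forall x, D x -> f x = g x) -> ratfun D g.

Lemma rat_funalg (U : normedModType R) (D : set U) :
  funalg (ratfun D) (fun f => forall x, D x -> f x != 0).
Proof.
by split; [exact: rat_cst|exact: ratD|exact: ratM|exact: ratV].
Qed.

Lemma rat_comp (U U' : normedModType R) (D : set U) (D' : set U')
    (g : U' -> U) (f : U -> R) :
  (forall l : {linear U -> R^o}, continuous l -> ratfun D' (fun x => l (g x))) ->
  (forall x, D' x -> D (g x)) -> ratfun D f -> ratfun D' (fun x => f (g x)).
Proof.
move=> gl gD; elim=> {f} [l lc|c|f h _ ? _ ?|f h _ ? _ ?|f _ ? f0|f h _ fr fh].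
- exact: gl.
- exact: rat_cst.
- exact: ratD.
- exact: ratM.
- by apply: ratV => // x /gD/f0.
- by apply: rat_ext fr _ => x /gD/fh.
Qed.

Lemma rat_continuous (U : normedModType R) (D : set U) f x :
  open D -> ratfun D f -> D x -> {for x, continuous f}.
Proof.
move=> oD fr Dx; elim: fr => {f} [l lc|c|f h _ ? _ ?|f h _ ? _ ?|f _ ? f0|f h _ fr fh].
- exact: lc.
- exact: cvg_cst.
- exact: (@cvgD _ R^o).
- exact: (@cvgM R).
- by apply: (@cvgV R) => //; exact: f0.
- rewrite /prop_for /continuous_at -(fh _ Dx); apply: cvg_trans fr; apply: near_eq_cvg.
  by near=> y; rewrite fh//; near: y; exact: open_nbhs_nbhs.
Unshelve. all: by end_near. Qed.

Lemma rat_derive (U : normedModType R) (D : set U) (f : U -> R^o) v :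
  open D -> ratfun D f ->
  (forall x, D x -> derivable f x v) /\ ratfun D (fun x => 'D_v f x : R).
Proof.
move=> oD; elim=> {f} [l lc|c|f h _ [fd fr] _ [hd hr]|f h rf [fd fr] rh [hd hr]
   |f rf [fd fr] f0|f h _ [fd fr] fh].
- have ld x : differentiable l x by exact: linear_differentiable.
  split=> [x _|]; first exact: diff_derivable.
  by apply: (rat_ext (rat_cst D (l v))) => x _; rewrite deriveE// diff_lin.
- split=> [x _|]; first exact: derivable_cst.
  by apply: (rat_ext (rat_cst D 0)) => x _; rewrite (derive_cst (c : R^o)).
- split=> [x Dx|]; first by apply: derivableD; [exact: fd|exact: hd].
  by apply: (rat_ext (ratD fr hr)) => x Dx; rewrite (deriveD (fd _ Dx) (hd _ Dx)).
- split=> [x Dx|]; first by apply: derivableM; [exact: fd|exact: hd].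
  apply: (rat_ext (ratD (ratM rf hr) (ratM rh fr))) => x Dx.
  by rewrite (deriveM (fd _ Dx) (hd _ Dx)).
- split=> [x Dx|]; first by apply: derivableV; [exact: f0|exact: fd].
  have nf2 := ratV (ratM rf rf) (fun x Dx => mulf_neq0 (f0 x Dx) (f0 x Dx)).
  apply: (rat_ext (ratM (rat_cst D (-1)) (ratM nf2 fr))) => x Dx.
  rewrite (deriveV (f0 _ Dx) (fd _ Dx)) /= mulN1r -mulNr.
  by rewrite [f x ^+ 2]expr2.
- have nfh x : D x -> {near x, f =1 h}.
    by move=> Dx; near=> y; apply: fh; near: y; exact: open_nbhs_nbhs.
  split=> [x Dx|]; first by apply: near_eq_derivable (fd _ Dx); exact: nfh.
  by apply: (rat_ext fr) => x Dx; apply: near_eq_derive; exact: nfh.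
Unshelve. all: by end_near. Qed.

Definition mxrat (U : normedModType R) (D : set U) m k (f : U -> 'M[R]_(m, k)) :=
  forall i j, ratfun D (fun x => f x i j).

Lemma mxrat_continuous (U : normedModType R) (D : set U) m k
    (f : U -> 'M[R]_(m, k)) x :
  open D -> mxrat D f -> D x -> {for x, continuous f}.
Proof. by move=> oD fr Dx; apply/cvg_mxP => i j; exact: rat_continuous (fr i j) Dx. Qed.

Lemma mxrat_smooth (U : normedModType R) (D : set U) m k (f : U -> 'M[R]_(m, k)) :
  open D -> mxrat D f -> smooth_on D f.
Proof.
move=> oD fr d; elim: d f fr => [|d IHd] f fr /=.
  by move=> x; exact: mxrat_continuous.
have fd x v : D x -> derivable f x v.
  by move=> Dx; apply/derivable_mxP => i j; exact: (rat_derive v oD (fr i j)).1.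
split=> // v; apply: IHd => i j.
apply: (rat_ext (rat_derive v oD (fr i j)).2) => x Dx.
by rewrite derive_mx ?mxE//; exact: fd.
Qed.

(* The difference quotients, whose values on the diagonal are the partial
   derivatives, are continuous up to the diagonal: this is what is used of the
   differentiability of [f]. *)
Lemma rat_hadamard m k (D : set 'M[R]_(m, k)) f : open D -> ratfun D f ->
  exists g : 'I_m -> 'I_k -> 'M[R]_(m, k) * 'M[R]_(m, k) -> R,
    (forall x y, D x -> D y ->
       f x - f y = \sum_i \sum_j g i j (x, y) * (x i j - y i j)) /\
    (forall x y, D x -> D y -> forall i j, {for (x, y), continuous (g i j)}).
Proof.
move=> oD; elim=> {f} [l lc|c|f h _ [f' [fE f'c]] _ [h' [hE h'c]]
   |f h rf [f' [fE f'c]] rh [h' [hE h'c]]|f rf [f' [fE f'c]] f0|f h _ [f' [fE f'c]] fh].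
- exists (fun i j _ => l (delta_mx i j)); split=> [x y _ _|x y _ _ i j].
    rewrite -(linearB l) {1}[x - y]matrix_sum_delta linear_sum; apply: eq_bigr => i _.
    by rewrite linear_sum; apply: eq_bigr => j _; rewrite linearZ !mxE/= mulrC.
  exact: cvg_cst.
- exists (fun i j _ => 0); split=> [x y _ _|x y _ _ i j]; last exact: cvg_cst.
  by rewrite subrr big1// => i _; rewrite big1// => j _; rewrite mul0r.
- exists (fun i j z => f' i j z + h' i j z); split=> [x y Dx Dy|x y Dx Dy i j].
    rewrite opprD addrACA fE// hE// -big_split; apply: eq_bigr => i _/=.
    by rewrite -big_split; apply: eq_bigr => j _/=; rewrite mulrDl.
  by apply: (@cvgD _ R^o); [exact: f'c|exact: h'c].
- exists (fun i j z => f' i j z * h z.1 + f z.2 * h' i j z).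
  split=> [x y Dx Dy|x y Dx Dy i j].
    transitivity ((f x - f y) * h x + f y * (h x - h y)).
      by rewrite mulrBl mulrBr subrKA.
    rewrite fE// hE// mulr_suml mulr_sumr -big_split; apply: eq_bigr => i _/=.
    rewrite mulr_suml mulr_sumr -big_split; apply: eq_bigr => j _/=.
    by rewrite mulrDl mulrAC mulrA.
  apply: (@cvgD _ R^o); apply: (@cvgM R); try exact: f'c; try exact: h'c.
    apply: (cvg_comp _ h (@cvg_fst _ _ _ _ _)) => //.
    exact: (rat_continuous oD rh Dx).
  apply: (cvg_comp _ f (@cvg_snd _ _ _ _ _)) => //.
  exact: (rat_continuous oD rf Dy).
- exists (fun i j z => - (f' i j z * ((f z.1)^-1 * (f z.2)^-1))).
  split=> [x y Dx Dy|x y Dx Dy i j].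
    transitivity (- ((f x - f y) * ((f x)^-1 * (f y)^-1))).
      rewrite mulrBl mulrA divff ?f0// mul1r mulrCA divff ?f0// mulr1.
      by rewrite opprB.
    rewrite fE// mulr_suml -sumrN; apply: eq_bigr => i _/=.
    rewrite mulr_suml -sumrN; apply: eq_bigr => j _/=.
    by rewrite mulrAC mulNr.
  apply: (@cvgN _ R^o); apply: (@cvgM R); first exact: f'c.
  apply: (@cvgM R); apply: (@cvgV R); try exact: f0.
    apply: (cvg_comp _ f (@cvg_fst _ _ _ _ _)) => //.
    exact: (rat_continuous oD rf Dx).
  apply: (cvg_comp _ f (@cvg_snd _ _ _ _ _)) => //.
  exact: (rat_continuous oD rf Dy).
- by exists f'; split=> // x y Dx Dy; rewrite -!fh// fE.
Qed.

End RationalFunctions.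

(** * Two-point difference quotients and the chain rule *)

Section Derivatives.
Variable R : realType.

Lemma cvg_sumr (T I : Type) (F : set_system T) {FF : Filter F} (r : seq I)
    (f : I -> T -> R) (l : I -> R) :
  (forall i, f i x @[x --> F] --> l i) ->
  \sum_(i <- r) f i x @[x --> F] --> \sum_(i <- r) l i.
Proof.
move=> fl; elim: r => [|i r IHr].
  rewrite big_nil (_ : (fun x => _) = fun=> 0); first exact: cvg_cst.
  by apply/funext => x; rewrite big_nil.
rewrite big_cons (_ : (fun x : T => _) = fun x => f i x + \sum_(i <- r) f i x).
  exact: (@cvgD _ R^o).
by apply/funext => x; rewrite big_cons.
Qed.

Lemma cvg_mulmx (T : Type) (F : set_system T) {FF : Filter F} m k l
    (A : T -> 'M[R]_(m, k)) (B : T -> 'M[R]_(k, l)) (A0 : 'M[R]_(m, k)) (B0 : 'M[R]_(k, l)) :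
  A @ F --> A0 -> B @ F --> B0 -> A x *m B x @[x --> F] --> A0 *m B0.
Proof.
move=> /cvg_mxP AA0 /cvg_mxP BB0; apply/cvg_mxP => i j; rewrite mxE.
rewrite (_ : (fun x : T => _) = fun x => \sum_l A x i l * B x l j).
  by apply: cvg_sumr => p; exact: (@cvgM R).
by apply/funext => x; rewrite mxE.
Qed.

(** On the diagonal, [G x x] is the differential at [x]. Continuity is stated jointly in the three
    arguments and along any filter, so that it serves for sequences of points as well as for
    difference quotients. *)
Definition hadamard m k p q (D : set 'M[R]_(m, k)) (f : 'M[R]_(m, k) -> 'M[R]_(p, q))
    (G : 'M[R]_(m, k) -> 'M[R]_(m, k) -> 'M[R]_(m, k) -> 'M[R]_(p, q)) : Prop :=
  [/\ forall x y, linear (G x y),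
      forall x y, D x -> D y -> f x - f y = G x y (x - y)
    & forall x y s (T : Type) (F : set_system T) (FF : Filter F) (a b c : T -> 'M[R]_(m, k)),
        D x -> D y -> a @ F --> x -> b @ F --> y -> c @ F --> s ->
        G (a t) (b t) (c t) @[t --> F] --> G x y s].

Lemma mxrat_hadamard m k p q (D : set 'M[R]_(m, k)) (f : 'M[R]_(m, k) -> 'M[R]_(p, q)) :
  open D -> mxrat D f -> exists G, hadamard D f G.
Proof.
move=> oD fr.
have gE (ij : 'I_p * 'I_q) := rat_hadamard oD (fr ij.1 ij.2).
pose g ij := sval (cid (gE ij)); have gP ij := svalP (cid (gE ij)).
rewrite -/(g _) in gP.
exists (fun x y s => \matrix_(i, j) \sum_a \sum_b g (i, j) a b (x, y) * s a b).
split.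
- move=> x y c s t; apply/matrixP => i j; rewrite !mxE mulr_sumr -big_split.
  apply: eq_bigr => a _/=; rewrite mulr_sumr -big_split; apply: eq_bigr => b _/=.
  by rewrite !mxE mulrDr mulrCA.
- move=> x y Dx Dy; apply/matrixP => i j; rewrite !mxE (gP (i, j)).1//.
  by apply: eq_bigr => a _; apply: eq_bigr => b _; rewrite !mxE.
move=> x y s T F FF a b c Dx Dy ax bx cx; apply/cvg_mxP => i j; rewrite mxE.
rewrite (_ : (fun t : T => _) = fun t =>
    \sum_l \sum_l' g (i, j) l l' (a t, b t) * c t l l'); last first.
  by apply/funext => t; rewrite mxE.
apply: cvg_sumr => l; apply: cvg_sumr => l'; apply: (@cvgM R); last first.
  by move/cvg_mxP : cx.
apply: (cvg_comp _ (g (i, j) l l') (cvg_pair ax bx)).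
exact: (gP (i, j)).2.
Qed.

Lemma derive_cvg (U V : normedModType R) (f : U -> V) a v l :
  h^-1 *: (f (h *: v + a) - f a) @[h --> (0 : R)^'] --> l ->
  derivable f a v /\ 'D_v f a = l.
Proof. by move=> fl; split; [apply/cvg_ex; exists l|exact/cvg_lim]. Qed.

Lemma derivable_line_cvg (V : normedModType R) (c : R^o -> V) :
  derivable c 0 1 -> h^-1 *: (c h - c 0) @[h --> (0 : R)^'] --> 'D_1 c 0.
Proof.
move=> cd; rewrite /derive.
rewrite (_ : (fun h => _) = (fun h => h^-1 *: ((c \o shift 0) (h *: 1) - c 0))) //.
by apply/funext => h; rewrite /= addr0 /GRing.scale/= mulr1.
Qed.

(** By linearity, the factor [h^-1] passes inside [G], where it meets the increment of [c]; the
    joint continuity of [G] then gives the limit. *)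
Lemma hadamard_chain m k p q (D : set 'M[R]_(m, k)) (f : 'M[R]_(m, k) -> 'M[R]_(p, q))
    G (c : R -> 'M[R]_(m, k)) s :
  open D -> hadamard D f G -> D (c 0) -> c @ 0 --> c 0 ->
  h^-1 *: (c h - c 0) @[h --> 0^'] --> s ->
  h^-1 *: (f (c h) - f (c 0)) @[h --> 0^'] --> G (c 0) (c 0) s.
Proof.
move=> oD [Glin GE Gc] Dc0 c0 cs.
have c0' : c @ (0 : R)^' --> c 0 by exact: cvg_trans (cvg_within_filter _ c0) _.
have H := Gc _ _ _ _ _ _ _ _ _ Dc0 Dc0 c0' (cvg_cst _) cs.
apply: cvg_trans (H _ _); apply: near_eq_cvg; near=> h.
rewrite /= GE//; last by near: h; apply: c0'; exact: open_nbhs_nbhs.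
pose g : {linear _ -> _} := HB.pack (G (c h) (c 0))
  (GRing.isLinear.Build _ _ _ _ _ (Glin (c h) (c 0))).
by rewrite -[LHS]/(g _) linearZ.
Unshelve. all: by end_near. Qed.
End Derivatives.

(** * Strata in a chart *)

Section Charts.
Variables (R : realType) (n N : nat).
Local Notation M := 'M[R]_n.
Local Notation V := 'cV[R]_N.

Lemma hadamard_derive m k p q (D : set 'M[R]_(m, k)) (f : 'M[R]_(m, k) -> 'M[R]_(p, q))
    G a s : open D -> hadamard D f G -> D a ->
  h^-1 *: (f (h *: s + a) - f a) @[h --> (0 : R)^'] --> G a a s.
Proof.
move=> oD fG Da; pose c h : 'M[R]_(m, k) := h *: s + a.
have c0 : c 0 = a by rewrite /c scale0r add0r.
have := @hadamard_chain _ _ _ _ _ _ _ _ c s oD fG; rewrite c0; apply => //.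
  rewrite -c0; apply: (@cvgD _ 'M[R]_(m, k)); last exact: cvg_cst.
  exact: (@scalel_continuous _ 'M[R]_(m, k)).
apply: cvg_near_cst; near=> h; rewrite /c addrK scalerA mulVf ?scale1r//.
by near: h; exact: nbhs_dnbhs_neq.
Unshelve. all: by end_near. Qed.

Lemma mxrat_derive_linear m k p q (D : set 'M[R]_(m, k)) (f : 'M[R]_(m, k) -> 'M[R]_(p, q)) a :
  open D -> mxrat D f -> D a -> linear (fun s => 'D_s f a).
Proof.
move=> oD fr Da; have [G fG] := mxrat_hadamard oD fr.
have E s : 'D_s f a = G a a s.
  exact: (derive_cvg (hadamard_derive oD fG Da)).2.
by move=> c s t; rewrite !E; case: fG => Glin _ _; rewrite Glin.
Qed.

Lemma mxrat_chain m k p q (D : set 'M[R]_(m, k)) (f : 'M[R]_(m, k) -> 'M[R]_(p, q))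
    (c : R^o -> 'M[R]_(m, k)) : open D -> mxrat D f -> D (c 0) ->
  {for 0, continuous c} -> derivable c 0 1 ->
  derivable (fun t : R^o => f (c t)) 0 1 /\
  'D_1 (fun t : R^o => f (c t)) 0 = 'D_('D_1 c 0) f (c 0).
Proof.
move=> oD fr Dc0 cc cd; have [G fG] := mxrat_hadamard oD fr.
have -> : 'D_('D_1 c 0) f (c 0) = G (c 0) (c 0) ('D_1 c 0).
  exact: (derive_cvg (hadamard_derive oD fG Dc0)).2.
have H := hadamard_chain oD fG Dc0 cc (derivable_line_cvg cd).
apply: derive_cvg; apply: cvg_trans H; apply: near_eq_cvg; near=> h.
by rewrite /= addr0 /GRing.scale/= mulr1.
Unshelve. all: by end_near. Qed.

Lemma scaler1_reg (h : R) : h *: (1 : R^o) = h.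
Proof. exact: mulr1. Qed.

Lemma rat_id (D : set R^o) : ratfun D (fun x : R^o => x).
Proof. by apply: (@rat_lin _ _ _ (idfun : {linear R^o -> R^o})) => x; exact: cvg_id. Qed.

Lemma tangent_line (X : set V) (phi : M -> V) a s (e : R) : mxrat setT phi -> 0 < e ->
  (forall t, `|t| < e -> X (phi (a + t *: s))) ->
  tangent_vector X (phi a) ('D_s phi a).
Proof.
move=> pr e0 Xe; pose c (t : R^o) : M := a + t *: s.
exists e, (fun t : R^o => phi (c t)).
have c0 : c 0 = a by rewrite /c scale0r addr0.
have cr : mxrat setT c.
  move=> i j; rewrite (_ : (fun x : R^o => _) = fun x => a i j + x * s i j); last first.
    by apply/funext => x; rewrite !mxE.
  apply: ratD; first exact: rat_cst.
  by apply: (ratM (f := fun x : R^o => x)); [exact: rat_id|exact: rat_cst].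
have cd : derivable c 0 1.
  apply/derivable_mxP => i j.
  by apply: (rat_derive _ _ (cr i j)).1 => //; exact: openT.
have cs : 'D_1 c 0 = s.
  apply: (derive_cvg _).2; apply: cvg_near_cst; near=> h.
  rewrite /c !addr0 scaler1_reg scale0r addr0 (addrC a) addrK scalerA mulVf ?scale1r//.
  by near: h; exact: nbhs_dnbhs_neq.
split=> //.
- apply: mxrat_smooth.
    rewrite (_ : [set t : R^o | _] = ball (0 : R^o) e); first exact: ball_open.
    by apply/seteqP; split => t; rewrite /ball/= sub0r normrN.
  move=> i j; apply: (rat_comp (D := setT)) (pr i j) => // l lc.
  rewrite (_ : (fun x : R^o => _) = fun x => l a + x * l s); last first.
    by apply/funext => x; rewrite linearD linearZ.
  apply: ratD; first exact: rat_cst.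
  by apply: (ratM (f := fun x : R^o => x)); [exact: rat_id|exact: rat_cst].
- by rewrite c0.
- rewrite derive1E -cs -c0.
  apply: (mxrat_chain openT pr _ _ cd).2 => //.
  exact: (mxrat_continuous openT cr).
Unshelve. all: by end_near. Qed.

(** As in [submanifold], the inverse [rho] lives on an open set of the ambient space. Which points
    of [O] are in the image of [phi] depends on the set under study and is left to separate
    hypotheses. *)
Record chart (phi : M -> V) (rho : V -> M) (O : set V) : Prop := Chart {
  chart_open : open O;
  chart_phi : mxrat setT phi;
  chart_rho : mxrat O rho;
  chart_dom : forall a, O (phi a);
  chartK : forall a, rho (phi a) = a }.

Definition supp (Q : 'I_n -> 'I_n -> bool) (a : M) :=
  forall i j, ~~ Q i j -> a i j = 0.

Variables (phi : M -> V) (rho : V -> M) (O : set V).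
Hypothesis ch : chart phi rho O.

(** Read through [rho], a curve in [X] stays near time 0 in a coordinate subspace; the entries that
    vanish along the curve have zero derivative. *)
Lemma tangent_chart (X : set V) Q a v :
  (forall p, X p -> O p -> exists2 b, supp Q b & p = phi b) ->
  tangent_vector X (phi a) v -> exists2 s, supp Q s & v = 'D_s phi a.
Proof.
move=> XQ [e [g [e0 gs gX g0 <-]]]; pose c (t : R^o) : M := rho (g t).
have D0 : [set t : R^o | `|t| < e] 0 by rewrite /= normr0.
have gc : {for 0, continuous g} by exact: (gs 0%N).
have gd : derivable g 0 1 by exact: (gs 1%N).1.
have Og0 : O (g 0) by rewrite g0; exact: (chart_dom ch).
have [cd cs] := mxrat_chain (chart_open ch) (chart_rho ch) Og0 gc gd.
have cc : {for 0, continuous c}.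
  apply: (continuous_comp gc).
  exact: (mxrat_continuous (chart_open ch) (chart_rho ch)).
have near_c : \forall t \near (0 : R^o), supp Q (c t) /\ g t = phi (c t).
  near=> t.
  have te : `|t| < e.
    near: t; apply/nbhs_normP; exists e => // t /=.
    by rewrite sub0r normrN.
  have Ogt : O (g t).
    by near: t; apply: gc; apply: open_nbhs_nbhs; split => //; exact: (chart_open ch).
  have [b bQ gb] := XQ _ (gX _ te) Ogt.
  by rewrite /c gb (chartK ch).
exists ('D_1 c 0) => [i j ij|].
  rewrite derive_mx// mxE (@near_eq_derive _ _ _ _ (fun=> 0)) ?derive_cst//.
  by near=> t; have [->] : supp Q (c t) /\ g t = phi (c t) by near: t.
have c0 : c 0 = a by rewrite /c g0 (chartK ch).
rewrite derive1E -c0.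
have [_ <-] := mxrat_chain openT (chart_phi ch) (I : setT (c 0)) cc cd.
apply: near_eq_derive; near=> t.
by have [_ ->] : supp Q (c t) /\ g t = phi (c t) by near: t.
Unshelve. all: by end_near. Qed.

(** Differentiating [rho (phi (t *: s + a)) = t *: s + a] at 0 recovers [s] from ['D_s phi a]. *)
Lemma derive_chart_inj a s : 'D_s phi a = 0 -> s = 0.
Proof.
move=> s0; have oT := @openT M.
have [G phiG] := mxrat_hadamard oT (chart_phi ch).
pose c (t : R^o) : V := phi (t *: s + a).
have c0 : c 0 = phi a by rewrite /c scale0r add0r.
have [_ pd] : derivable phi a s /\ 'D_s phi a = G a a s.
  exact: derive_cvg (hadamard_derive oT phiG I).
have cd : derivable c 0 1 /\ 'D_1 c 0 = 'D_s phi a.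
  rewrite pd; apply: derive_cvg.
  have H : h^-1 *: (phi (h *: s + a) - phi a) @[h --> (0 : R)^'] --> G a a s.
    exact: hadamard_derive oT phiG I.
  apply: cvg_trans H; apply: near_eq_cvg; near=> h.
  by rewrite /= addr0 /GRing.scale/= mulr1 -c0.
have cc : {for 0, continuous c}.
  apply: (continuous_comp (f := fun t : R^o => t *: s + a)).
    apply: (@cvgD _ M); last exact: cvg_cst.
    exact: (@scalel_continuous _ M).
  exact: (mxrat_continuous oT (chart_phi ch)).
have Oc0 : O (c 0) by rewrite c0; exact: (chart_dom ch).
have [_] := mxrat_chain (chart_open ch) (chart_rho ch) Oc0 cc cd.1.
rewrite cd.2 s0 derive0 => <-; symmetry.
apply: (derive_cvg _).2; apply: cvg_near_cst; near=> h.
rewrite /c !(chartK ch) addr0 scale0r add0r addrK scalerA.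
rewrite scaler1_reg mulVf ?scale1r//.
by near: h; exact: nbhs_dnbhs_neq.
Unshelve. all: by end_near. Qed.

End Charts.

Lemma mx_cvg_unique (R : realType) m k (T : Type) (F : set_system T)
    {FF : ProperFilter F} (f : T -> 'M[R]_(m, k)) (a b : 'M[R]_(m, k)) :
  f @ F --> a -> f @ F --> b -> a = b.
Proof.
by move=> fa fb; rewrite -(cvg_lim (@norm_hausdorff _ _) fa); exact: cvg_lim.
Qed.

(** * Coordinate subspaces of matrices *)

Section SupportedMatrices.
Variables (R : realType) (n : nat).
Local Notation M := 'M[R]_n.
Variable Q : 'I_n -> 'I_n -> bool.

Definition support_card := #|[set ij : 'I_n * 'I_n | Q ij.1 ij.2]|.
Local Notation d := support_card.

Definition supp_entry (k : 'I_d) : 'I_n * 'I_n := enum_val k.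

Definition supp_incl (u : 'cV[R]_d) : M :=
  \sum_k u k 0 *: delta_mx (supp_entry k).1 (supp_entry k).2.

Definition supp_proj (a : M) : 'cV[R]_d := \col_k a (supp_entry k).1 (supp_entry k).2.

Lemma supp_inclK : cancel supp_incl supp_proj.
Proof.
move=> u; apply/matrixP => k l; rewrite ord1 mxE summxE (bigD1 k)//= big1.
  by rewrite addr0 !mxE !eqxx mulr1.
move=> i ik; rewrite !mxE; case: eqVneq => [e1|]; last by rewrite mulr0.
case: eqVneq => [e2|]; last by rewrite mulr0.
case/eqP: ik; apply: enum_val_inj; rewrite -/(supp_entry i) -/(supp_entry k).
by rewrite [supp_entry i]surjective_pairing -e1 -e2 -surjective_pairing.
Qed.

Lemma supp_incl_supp u : supp Q (supp_incl u).
Proof.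
move=> i j ij; rewrite summxE big1// => k _; rewrite !mxE.
case: eqVneq => [e1|]; last by rewrite mulr0.
case: eqVneq => [e2|]; last by rewrite mulr0.
have : Q (supp_entry k).1 (supp_entry k).2 by have := enum_valP k; rewrite inE.
by rewrite -e1 -e2 (negPf ij).
Qed.

Lemma supp_projK a : supp Q a -> supp_incl (supp_proj a) = a.
Proof.
move=> aQ; apply/matrixP => i j; have [Qij|Qij] := boolP (Q i j); last first.
  by rewrite (supp_incl_supp _ Qij) aQ.
have ijQ : (i, j) \in [set ij : 'I_n * 'I_n | Q ij.1 ij.2] by rewrite inE.
pose k : 'I_d := enum_rank_in ijQ (i, j).
have kE : supp_entry k = (i, j) by rewrite /supp_entry enum_rankK_in.
have := supp_inclK (supp_proj a) => /(congr1 (fun u : 'cV_d => u k 0)).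
by rewrite !mxE kE.
Qed.

Lemma supp_incl_linear : linear supp_incl.
Proof.
move=> c u v; rewrite /supp_incl scaler_sumr -big_split; apply: eq_bigr => k _ /=.
by rewrite !mxE scalerDl scalerA.
Qed.

Lemma suppD (a b : M) : supp Q a -> supp Q b -> supp Q (a + b).
Proof. by move=> aQ bQ i j ij; rewrite mxE aQ// bQ// addr0. Qed.

Lemma suppZ c (a : M) : supp Q a -> supp Q (c *: a).
Proof. by move=> aQ i j ij; rewrite mxE aQ// mulr0. Qed.

End SupportedMatrices.

(** * Whitney conditions for a stratum that is conical and translation-invariant in a chart *)

Section Submanifolds.
Variables (R : realType) (n N : nat).
Local Notation M := 'M[R]_n.
Local Notation V := 'cV[R]_N.

Lemma rat_mxentry m k (D : set 'M[R]_(m, k)) i j : ratfun D (fun A => A i j).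
Proof.
have lin : linear (fun v : 'M[R]_(m, k) => v i j : R^o) by move=> c u v; rewrite !mxE.
pose l : {linear 'M[R]_(m, k) -> R^o} := HB.pack (fun v : 'M[R]_(m, k) => v i j : R^o)
  (GRing.isLinear.Build _ _ _ _ _ lin).
by apply: (@rat_lin _ _ _ l); exact: coord_continuous.
Qed.

(** The chart may depend on the point: a cell lies in a single one, but the Lagrangian Grassmannian
    is covered by several. *)
Lemma submanifold_chart (Q : 'I_n -> 'I_n -> bool) (X : set V) :
  (forall p, X p -> exists phi rho O, [/\ @chart R n N phi rho O, O p &
     forall q, X q /\ O q <-> exists2 b, supp Q b & q = phi b]) ->
  submanifold (support_card Q) X.
Proof.
move=> Xch p /Xch[phi [rho [D [pch Dp XD]]]].
exists setT, D, (phi \o @supp_incl R n Q), (@supp_proj R n Q \o rho).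
split; first by split => //; [exact: openT|exact: chart_open pch].
split.
- apply: mxrat_smooth; first exact: openT.
  move=> i j; apply: (rat_comp (D := setT)) (chart_phi pch i j) => // l lc.
  rewrite (_ : (fun x => _) = fun x : 'cV_(support_card Q) => \sum_k x k 0 *
      l (delta_mx (supp_entry k).1 (supp_entry k).2)); last first.
    by apply/funext => x; rewrite linear_sum; apply: eq_bigr => k _; rewrite linearZ.
  apply: (funalg_sum (rat_funalg _)) => k; apply: ratM; last exact: rat_cst.
  exact: rat_mxentry.
- apply: mxrat_smooth; first exact: chart_open pch.
  move=> i j; apply: (rat_ext (chart_rho pch (supp_entry i).1 (supp_entry i).2)).
  by move=> x _; rewrite /= mxE.
- apply/seteqP; split=> [_ [u _ <-]|q /XD[b bQ ->]].
    by apply/XD; exists (supp_incl u) => //; exact: supp_incl_supp.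
  by exists (supp_proj Q b) => //=; rewrite supp_projK.
- by move=> u _ /=; rewrite (chartK pch) supp_inclK.
Qed.

Variables (phi : M -> V) (rho : V -> M) (O : set V).
Hypothesis ch : chart phi rho O.
Local Notation oT := (@openT M).

Lemma connected_chart_supp (Q : 'I_n -> 'I_n -> bool) : connected (phi @` supp Q).
Proof.
rewrite (_ : phi @` _ = \bigcup_(a in supp Q) ((fun t : R => phi (t *: a)) @` `[0, 1])).
  apply: bigcup_connected.
    exists (phi 0) => a _; exists 0; last by rewrite scale0r.
    by rewrite /= in_itv/= lexx ler01.
  move=> a _; apply: connected_continuous_connected; first exact: segment_connected.
  apply: continuous_subspaceT => t.
  apply: (@continuous_comp _ _ _ (fun t : R => t *: a)).
    exact: (@scalel_continuous _ M).
  exact: (mxrat_continuous oT (chart_phi ch)).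
apply/seteqP; split=> [_ [a aQ <-]|_ [a aQ [t _ <-]]].
  exists a => //; exists 1; last by rewrite scale1r.
  by rewrite /= in_itv/= lexx ler01.
by exists (t *: a) => //; exact: suppZ.
Qed.

Lemma chart_cvg (T : Type) (F : set_system T) {FF : Filter F} (x : T -> V) a :
  x @ F --> phi a -> rho (x t) @[t --> F] --> a /\ \forall t \near F, O (x t).
Proof.
move=> xa; split.
  rewrite -[a in X in _ --> X](chartK ch).
  apply: (cvg_comp _ rho xa).
  by apply: (mxrat_continuous (chart_open ch) (chart_rho ch)); exact: chart_dom ch _.
by apply: xa; apply: open_nbhs_nbhs; split; [exact: chart_open ch|exact: chart_dom ch _].
Qed.

Variables (Q : 'I_n -> 'I_n -> bool) (X Y : set V).
Hypothesis X_translate : forall a s, supp Q s -> X (phi a) -> X (phi (a + s)).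
Hypothesis X_scale : forall a c, 0 < c -> X (phi a) -> X (phi (c *: a)).
Hypothesis X_chart : forall p, X p -> O p -> exists a, p = phi a.
Hypothesis YE : forall p, Y p <-> exists2 a, supp Q a & p = phi a.

Lemma tangent_cone a s c : X (phi a) -> supp Q s ->
  tangent_vector X (phi a) ('D_(s + c *: a) phi a).
Proof.
(* For [t] below this bound the dilation factor [1 + t * c] stays positive, whatever the sign of
   [c]. *)
move=> Xa sQ; have e0 : 0 < (1 + `|c|)^-1 by rewrite invr_gt0 ltr_wpDr.
apply: (tangent_line (chart_phi ch) e0) => t te.
rewrite (_ : _ + _ = (1 + t * c) *: a + t *: s); last first.
  by rewrite scalerDl scale1r scalerDr scalerA -addrA [_ + t *: s]addrC.
apply: X_translate; first exact: suppZ.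
apply: X_scale => //; rewrite -ltrBlDr sub0r.
apply: (@le_lt_trans _ _ `|t * c|); first by rewrite -normrN ler_norm.
rewrite normrM; have [->|c0] := eqVneq c 0; first by rewrite normr0 mulr0.
apply: (@lt_le_trans _ _ ((1 + `|c|)^-1 * `|c|)); first by rewrite ltr_pM2r ?normr_gt0.
by rewrite mulrC ler_pdivrMr ?mul1r ?lerDr ?ltr_wpDr.
Qed.

(** Membership is the equation [P w = w] for the orthogonal projection [P], and this equation passes
    to the limit. *)
Lemma grass_cvg_mem (T : nat -> {vspace V}) tau (w : nat -> V) v :
  grass_cvg T tau -> w @ \oo --> v -> (\forall k \near \oo, w k \in T k) -> v \in tau.
Proof.
move=> Ttau wv wT; suff <- : orthproj idfun tau *m v = v by exact: orthproj_mem.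
apply: (mx_cvg_unique (cvg_mulmx Ttau wv)).
apply: cvg_trans wv; apply: near_eq_cvg; near=> k.
rewrite (orthproj_id (@real_definite R))//; by near: k.
Unshelve. all: by end_near. Qed.

(** For a fixed [s] in the directions of [Y], translation invariance makes ['D_s phi] at [rho (x k)]
    tangent to [X], and these vectors converge to ['D_s phi a]. *)
Lemma whitney_a_chart : whitney_a X Y.
Proof.
move=> y x T tau /YE[a aQ ->] Xx xy TX Ttau v.
have YQ p : Y p -> O p -> exists2 b, supp Q b & p = phi b by move=> /YE.
move=> /(tangent_chart ch YQ)[s sQ ->].
have [xa Ox] := chart_cvg xy.
have [G phiG] := mxrat_hadamard oT (chart_phi ch).
have DE b t : 'D_t phi b = G b b t.
  exact: (derive_cvg (hadamard_derive oT phiG I)).2.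
apply: (grass_cvg_mem Ttau (w := fun k => 'D_s phi (rho (x k)))).
  rewrite DE; under eq_cvg do rewrite DE.
  by case: phiG => _ _; apply => //; exact: cvg_cst.
near=> k; have Oxk : O (x k) by near: k.
apply/TX; have [b xb] := X_chart (Xx k) Oxk; rewrite xb (chartK ch).
by rewrite -[s]addr0 -(scale0r b); apply: tangent_cone => //; rewrite -xb.
Unshelve. all: by end_near. Qed.

(** A vector [u] of [l] is the limit of its projections [U k] on the secants, which spares a
    normalisation. The quotient of [rho] sends [U k] to a vector [W k] of the chart; from it, [G] at
    the two ends of the secant recovers [U k], whereas [G] taken twice at [x k] gives a tangent
    vector of [X]. The two limits agree by continuity of [G] at [(a, a)]. *)
Lemma whitney_b_chart : whitney_b X Y.
Proof.
move=> y x z T tau l /YE[a aQ ->] Xx Yz xz xy zy TX Ttau zl.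
have [xa Ox] := chart_cvg xy; have [za Oz] := chart_cvg zy.
have [G phiG] := mxrat_hadamard oT (chart_phi ch).
have [H rhoH] := mxrat_hadamard (chart_open ch) (chart_rho ch).
have DE b t : 'D_t phi b = G b b t.
  exact: (derive_cvg (hadamard_derive oT phiG I)).2.
have Oa : O (phi a) by exact: chart_dom ch _.
apply/subvP => u ul.
pose U k := orthproj idfun <[x k - z k]> *m u.
have Uu : U @ \oo --> u.
  rewrite -[u in X in _ --> X](orthproj_id (@real_definite R) ul).
  by apply: cvg_mulmx => //; exact: cvg_cst.
pose W k := H (x k) (z k) (U k).
have Wl : W @ \oo --> H (phi a) (phi a) u by case: rhoH => _ _; exact.
have Gl : G (rho (x k)) (rho (x k)) (W k) @[k --> \oo] -->
    G a a (H (phi a) (phi a) u) by case: phiG => _ _; exact.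
have Gl' : G (rho (x k)) (rho (z k)) (W k) @[k --> \oo] -->
    G a a (H (phi a) (phi a) u) by case: phiG => _ _; exact.
have key : \forall k \near \oo, G (rho (x k)) (rho (z k)) (W k) = U k /\
    G (rho (x k)) (rho (x k)) (W k) \in T k.
  near=> k; have Oxk : O (x k) by near: k.
  have Ozk : O (z k) by near: k.
  have [b xb] := X_chart (Xx k) Oxk.
  have [b' b'Q zb'] := (YE _).1 (Yz k).
  have /vlineP[c Uc] : U k \in <[x k - z k]>%VS by exact: orthproj_mem.
  (* In the chart, the secant [b - b'] is tangent to [X] at [b], as [X] is
     invariant under dilations and translations by [- b']. *)
  have Wc : W k = c *: (b - b').
    rewrite /W Uc; case: rhoH => Hlin HE _.
    pose h : {linear _ -> _} := HB.pack (H (x k) (z k))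
      (GRing.isLinear.Build _ _ _ _ _ (Hlin (x k) (z k))).
    rewrite -[LHS]/(h _) linearZ/= -HE//.
    by rewrite xb zb' !(chartK ch).
  rewrite {1}xb zb' !(chartK ch) Wc; split.
    case: phiG => Glin GE _.
    pose g : {linear _ -> _} := HB.pack (G b b')
      (GRing.isLinear.Build _ _ _ _ _ (Glin b b')).
    by rewrite -[LHS]/(g _) linearZ/= -GE// Uc xb zb'.
  rewrite xb (chartK ch) -DE; apply/TX; rewrite xb.
  rewrite scalerBr addrC -scaleNr; apply: tangent_cone; first by rewrite -xb.
  exact: suppZ.
have uE : G a a (H (phi a) (phi a) u) = u.
  apply: (mx_cvg_unique Gl').
  by apply: cvg_trans Uu; apply: near_eq_cvg; apply: filterS key => k [].
by rewrite -uE; apply: (grass_cvg_mem Ttau Gl); apply: filterS key => k [].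
Unshelve. all: by end_near. Qed.

End Submanifolds.

(** * Frontier condition and inequality between dimensions *)

Section ConicalStrata.
Variables (R : realType) (n N : nat).
Local Notation M := 'M[R]_n.
Local Notation V := 'cV[R]_N.
Local Notation oT := (@openT M).

Lemma tangent_vectorS (X Y : set V) p v : X `<=` Y ->
  tangent_vector X p v -> tangent_vector Y p v.
Proof.
move=> XY [e [g [e0 gs gX g0 gd]]]; exists e, g; split => // t te.
exact/XY/gX.
Qed.

Variables (phi : M -> V) (rho : V -> M) (O : set V).
Hypothesis ch : chart phi rho O.

Definition deriv_lin a : {linear M -> V} := HB.pack (fun s => 'D_s phi a)
  (GRing.isLinear.Build _ _ _ _ _ (mxrat_derive_linear oT (chart_phi ch) I)).

Variables (Q : 'I_n -> 'I_n -> bool) (X Y : set V).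
Hypothesis X_translate : forall a s, supp Q s -> X (phi a) -> X (phi (a + s)).
Hypothesis X_chart : forall p, X p -> O p -> exists a, p = phi a.
Hypothesis YE : forall p, Y p <-> exists2 a, supp Q a & p = phi a.

Lemma closure_chart p : Y p -> closure X p -> exists2 a, X (phi a) & O (phi a).
Proof.
move=> /YE[a aQ ->] /(_ O)[|q [Xq Oq]].
  by apply: open_nbhs_nbhs; split; [exact: chart_open ch|exact: chart_dom ch _].
by have [b qb] := X_chart Xq Oq; exists b; rewrite -qb.
Qed.

Lemma frontier_chart : Y `&` closure X !=set0 -> Y `<=` closure X.
Proof.
move=> [_ [/YE[a aQ ->] Xa]] _ /YE[b bQ ->] B Bb.
(* In the chart, [f] is the translation from [a] to [b], by a vector with support in [Q]: it
   preserves [X] and turns points of [X] close to [phi a] into points of [X] close to [phi b]. *)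
pose f q := phi (rho q + (b - a)).
have fc : f q @[q --> phi a] --> phi b.
  have <- : f (phi a) = phi b by rewrite /f (chartK ch) subrKC.
  apply: (@continuous_comp _ _ _ (fun q => rho q + (b - a))); last first.
    exact: (mxrat_continuous oT (chart_phi ch)).
  have rc : rho q @[q --> phi a] --> rho (phi a).
    by apply: (mxrat_continuous (chart_open ch) (chart_rho ch)); exact: chart_dom ch _.
  exact: (cvgD rc (cvg_cst _)).
have [|q [Xq [Bq Oq]]] := Xa ((f @^-1` B) `&` O).
  apply: filterI; first exact: fc.
  by apply: open_nbhs_nbhs; split; [exact: chart_open ch|exact: chart_dom ch _].
exists (f q); split => //; have [c qc] := X_chart Xq Oq.
rewrite /f qc (chartK ch); apply: X_translate; last by rewrite -qc.
by apply: suppD => //; rewrite -scaleN1r; exact: suppZ.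
Qed.

Definition supp_lin : {linear 'cV[R]_(support_card Q) -> M} :=
  HB.pack (@supp_incl R n Q) (GRing.isLinear.Build _ _ _ _ _ (@supp_incl_linear R n Q)).

Lemma dim_supp : \dim (limg (linfun supp_lin)) = support_card Q.
Proof.
rewrite limg_dim_eq ?dimvf /dim/= ?muln1//.
apply/eqP; rewrite -subv0; apply/subvP => u; rewrite memv_cap memv_ker (lfunE supp_lin)/=.
move=> /andP[_ /eqP u0]; rewrite memv0 -[u](@supp_inclK R n Q) u0.
by apply/eqP/matrixP => i j; rewrite !mxE.
Qed.

Lemma mem_supp_lin a : (a \in limg (linfun supp_lin)) <-> supp Q a.
Proof.
split=> [/memv_imgP[u _ ->]|aQ]; first by rewrite lfunE/=; exact: supp_incl_supp.
apply/memv_imgP; exists (supp_proj Q a); first exact: memvf.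
by rewrite lfunE/= supp_projK.
Qed.

End ConicalStrata.

Section Dimension.
Variables (R : realType) (n N : nat).
Local Notation M := 'M[R]_n.
Local Notation V := 'cV[R]_N.
Variables (phi : M -> V) (rho : V -> M) (O : set V) (ch : chart phi rho O).
Variables (psi : M -> V) (sigma : V -> M) (P : set V) (ch' : chart psi sigma P).
Variables (Q Q' : 'I_n -> 'I_n -> bool) (X : set V).
Hypothesis X_translate : forall a s, supp Q s -> X (phi a) -> X (phi (a + s)).
Hypothesis X_scale : forall a c, 0 < c -> X (phi a) -> X (phi (c *: a)).
Hypothesis XE : forall p, X p -> exists2 b, supp Q' b & p = psi b.

(* At [a], the tangent space of [X] contains the image of the matrices with
   support in [Q], and also that of [a] itself since [X] is conical. *)
Lemma support_card_lt a : X (phi a) -> ~ supp Q a ->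
  (support_card Q < support_card Q')%N.
Proof.
move=> Xa aQ; have [b bQ' ab] := XE Xa.
pose W := (limg (linfun (supp_lin R Q)) + <[a]>)%VS.
have a0 : a != 0 by apply: contra_notN aQ => /eqP -> i j _; rewrite mxE.
have dW : \dim W = (support_card Q).+1.
  rewrite dimv_disjoint_sum ?dim_supp ?dim_vline ?a0 ?addn1//.
  apply/eqP; rewrite -subv0; apply/subvP => s; rewrite memv_cap memv0.
  case/andP => sQ /vlineP[c sc]; have [c0|c0] := eqVneq c 0.
    by rewrite sc c0 scale0r.
  case: aQ; rewrite -[a](scalerK c0) -sc; apply: suppZ; exact/mem_supp_lin.
(* Two charts meet at this point: the first is adapted to the small stratum, the second to [X].
   Injectivity of [f] preserves the dimension of [W], and [f @: W] consists of tangent vectors of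
   [X], which all lie in the image by [g] of the matrices with support in [Q']. *)
pose f := linfun (deriv_lin ch a); pose g := linfun (deriv_lin ch' b).
have dfW : \dim (f @: W) = (support_card Q).+1.
  rewrite limg_dim_eq//; apply/eqP; rewrite -subv0; apply/subvP => s.
  rewrite memv_cap memv_ker memv0 lfunE/= => /andP[_ /eqP s0].
  exact/eqP/(derive_chart_inj ch s0).
rewrite -dfW -(dim_supp R Q').
apply: (@leq_trans (\dim (g @: limg (linfun (supp_lin R Q'))))); last first.
  by rewrite -(limg_ker_dim g (limg _)) leq_addl.
apply: dimvS; apply/subvP => _ /memv_imgP[s sW ->].
have [s1 s1Q [s2 /vlineP[c s2c] s12]] := memv_addP sW.
have XQ' p : X p -> P p -> exists2 d, supp Q' d & p = psi d by move=> /XE.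
have : tangent_vector X (phi a) ('D_s phi a).
  rewrite s12 s2c; apply: (tangent_cone ch X_translate X_scale) => //.
  exact/mem_supp_lin.
rewrite {1}ab => /(tangent_chart ch' XQ')[t tQ' st].
rewrite lfunE/= st; apply/memv_imgP; exists t; first exact/mem_supp_lin.
by rewrite lfunE.
Qed.

End Dimension.

(** * Transversality in a chart *)

Section Transversality.
Variables (R : realType) (n N : nat).
Local Notation M := 'M[R]_n.
Local Notation V := 'cV[R]_N.

Variables (Q : 'I_n -> 'I_n -> bool) (Z X Y : set V).
Hypothesis Zsub : exists d, submanifold d Z.
Hypothesis Xsub : exists d, submanifold d X.
Hypothesis Ysub : exists d, submanifold d Y.
Hypothesis XZ : X `<=` Z.
Hypothesis YZ : Y `<=` Z.
Variables (phi : M -> V) (rho : V -> M) (O : set V) (ch : chart phi rho O).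
Hypothesis Z_phi : forall a, Z (phi a).
Hypothesis Z_chart : forall p, Z p -> O p -> exists a, p = phi a.
Hypothesis X_translate : forall a s, supp Q s -> X (phi a) -> X (phi (a + s)).
Hypothesis YE : forall p, Y p <->
  exists2 a, supp (fun i j => ~~ Q i j) a & p = phi a.

Lemma transverse_chart : transverse Z X Y.
Proof.
split=> // p Xp /YE[a aQ pa] v; rewrite {}pa in Xp *.
have Zv w : tangent_vector Z (phi a) w <-> exists s, w = 'D_s phi a.
  split=> [|[s ->]]; last exact: (tangent_line (chart_phi ch) ltr01).
  have ZT q : Z q -> O q -> exists2 b, supp (fun _ _ => true) b & q = phi b.
    by move=> Zq /(Z_chart Zq)[b ->]; exists b.
  by move=> /(tangent_chart ch ZT)[s _ ->]; exists s.
split=> [/Zv[s ->]|[x [y [/(tangent_vectorS XZ)/Zv[s ->] /(tangent_vectorS YZ)/Zv[t ->] ->]]]].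
  (* The part [s1] is tangent to [X] by translation invariance, and [s2] to [Y], which is the
     complementary coordinate subspace. *)
  pose s1 : M := \matrix_(i, j) if Q i j then s i j else 0.
  pose s2 : M := \matrix_(i, j) if Q i j then 0 else s i j.
  exists ('D_s1 phi a), ('D_s2 phi a); split.
  - apply: (tangent_line (chart_phi ch) ltr01) => t _; apply: X_translate => //.
    by apply: suppZ => i j /negPf Qij; rewrite mxE Qij.
  - apply: (tangent_line (chart_phi ch) ltr01) => t _; apply/YE.
    exists (a + t *: s2) => //; apply: suppD => //.
    by apply: suppZ => i j /negbNE Qij; rewrite mxE Qij.
  - rewrite -[LHS]/(deriv_lin ch a s) -[RHS]/(deriv_lin ch a s1 + deriv_lin ch a s2).
    rewrite -linearD; congr (deriv_lin ch a _); apply/matrixP => i j; rewrite !mxE.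
    by case: ifP; rewrite ?addr0 ?add0r.
apply/Zv; exists (s + t).
by rewrite -[RHS]/(deriv_lin ch a (s + t)) linearD.
Qed.

End Transversality.

(** * Hermitian Lagrangians as graphs *)

Section LagrangianFrames.
Variables (R : realType) (n : nat).
Local Notation C := R[i].
Local Notation adj := (adjmx (@conjc R)).
Implicit Types (I : {set 'I_n}) (T : 'M[C]_n) (F : 'M[C]_(n + n, n)).

Lemma injmx_left m k (G : 'M[C]_(k, m)) (F : 'M[C]_(m, k)) :
  G *m F \in unitmx -> injmx F.
Proof.
move=> GF x Fx; rewrite -[x](mulKmx GF) -mulmxA Fx !mulmx0 //.
Qed.

Lemma adj_scalar m k (F : 'M[C]_(m, k)) : injmx F -> adj F *m F \in unitmx.
Proof. exact: (adjmx_mul_injmx (@conjcK R) (@complex_definite R)). Qed.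

Definition dmx (P : pred 'I_n) : 'M[C]_n := diag_mx (\row_i (P i)%:R).

Lemma dmxM (P P' : pred 'I_n) : dmx P *m dmx P' = dmx (fun i => P i && P' i).
Proof.
rewrite mulmx_diag; congr diag_mx; apply/matrixP => i j; rewrite !mxE.
by case: (P j); rewrite ?mul1r ?mul0r.
Qed.

Lemma dmx_adj (P : pred 'I_n) : adj (dmx P) = dmx P.
Proof.
apply/matrixP => i j; rewrite adjmxE !mxE eq_sym; case: eqVneq => [->|_].
  by rewrite !mulr1n rmorph_nat.
by rewrite !mulr0n rmorph0.
Qed.

Lemma dmxC (P : pred 'I_n) : dmx P + dmx (fun i => ~~ P i) = 1%:M.
Proof.
apply/matrixP => i j; rewrite !mxE; case: eqVneq => [->|_]; last by rewrite !mulr0n addr0.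
by case: (P j); rewrite !mulr1n ?addr0 ?add0r.
Qed.

Lemma dmx0 (P : pred 'I_n) : (forall i, ~~ P i) -> dmx P = 0.
Proof.
by move=> P0; apply/matrixP => i j; rewrite !mxE (negPf (P0 _)) mul0rn.
Qed.

Definition Jmx : 'M[C]_(n + n) := block_mx 0 (- 1%:M) 1%:M 0.

Lemma JmxE : @Jhat R n = mulmx Jmx.
Proof.
apply/funext => v; rewrite /Jhat -{3}[v]vsubmxK mul_block_col.
by rewrite !mul0mx mulNmx !mul1mx add0r addr0.
Qed.

Lemma JmxK m (A : 'M[C]_(n + n, m)) : Jmx *m (Jmx *m A) = - A.
Proof.
have -> : Jmx *m (Jmx *m A) = - 1%:M *m A; last by rewrite mulNmx mul1mx.
rewrite mulmxA mulmx_block !mul0mx !mulmx0 mulmx1 mul1mx !(add0r, addr0).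
by rewrite scalar_mx_block opp_block_mx !oppr0.
Qed.

(* The columns of [BI I] are the basis [e_i] (for [i] in [I]), [f_i] (for the
   other [i]) of [Lambda I], and those of [CI I] are their images by [J]. *)
Definition BI I : 'M[C]_(n + n, n) :=
  col_mx (dmx (fun i => i \in I)) (dmx (fun i => i \notin I)).
Definition CI I : 'M[C]_(n + n, n) :=
  col_mx (- dmx (fun i => i \notin I)) (dmx (fun i => i \in I)).

Lemma adj_col_mx m1 m2 k (A : 'M[C]_(m1, k)) (B : 'M[C]_(m2, k)) :
  adj (col_mx A B) = row_mx (adj A) (adj B).
Proof. by rewrite /adjmx map_col_mx tr_col_mx. Qed.

Lemma Jmx_BI I : Jmx *m BI I = CI I.
Proof. by rewrite mul_block_col !mul0mx mulNmx !mul1mx add0r addr0. Qed.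

Lemma Jmx_CI I : Jmx *m CI I = - BI I.
Proof. by rewrite -Jmx_BI JmxK. Qed.

Lemma dmx_disj I : dmx (fun i => (i \in I) && (i \notin I)) = 0.
Proof. by apply: dmx0 => i; case: (i \in I). Qed.

Lemma dmx_disj' I : dmx (fun i => (i \notin I) && (i \in I)) = 0.
Proof. by apply: dmx0 => i; case: (i \in I). Qed.

Lemma dmx_id (P : pred 'I_n) : dmx (fun i => P i && P i) = dmx P.
Proof. by congr dmx; apply/funext => i; rewrite andbb. Qed.

Let dE := (dmx_adj, dmxM, dmx_disj, dmx_disj', dmx_id).

Lemma BI_BI I : adj (BI I) *m BI I = 1%:M.
Proof. by rewrite adj_col_mx mul_row_col !dE dmxC. Qed.

Lemma CI_CI I : adj (CI I) *m CI I = 1%:M.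
Proof.
by rewrite adj_col_mx mul_row_col adjmxN mulNmx mulmxN opprK !dE addrC dmxC.
Qed.

Lemma BI_CI I : adj (BI I) *m CI I = 0.
Proof. by rewrite adj_col_mx mul_row_col mulmxN !dE oppr0 addr0. Qed.

Lemma CI_BI I : adj (CI I) *m BI I = 0.
Proof. by rewrite adj_col_mx mul_row_col adjmxN mulNmx !dE oppr0 addr0. Qed.

Lemma BI_CI_sum I : BI I *m adj (BI I) + CI I *m adj (CI I) = 1%:M.
Proof.
rewrite !adj_col_mx !mul_col_row add_block_mx adjmxN !mulNmx !mulmxN opprK !dE.
by rewrite oppr0 !addr0 dmxC addrC dmxC -scalar_mx_block.
Qed.

Lemma injmx_JF F : injmx F -> injmx (Jmx *m F).
Proof.
move=> Fi x; rewrite -mulmxA => /(congr1 (mulmx Jmx)); rewrite JmxK mulmx0.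
by move=> /eqP; rewrite oppr_eq0 => /eqP/Fi.
Qed.

(** The equation says that [J L] is contained in the orthogonal of [L]; both have dimension [n], so
    the inclusion is an equality. *)
Lemma Lag_frame F : injmx F -> Lag_h (colspan F) <-> adj F *m Jmx *m F = 0.
Proof.
move=> Fi; rewrite /Lag_h /= JmxE colspan_limg; split=> [FE|F0].
  apply/matrixP => i j; rewrite [RHS]mxE.
  have : Jmx *m F *m delta_mx j 0 \in orthv (@conjc R) (colspan F).
    by rewrite FE; apply/colspanP; exists (delta_mx j 0).
  rewrite orthv_colspan !mulmxA => /eqP/matrixP/(_ i 0).
  by rewrite -colE !mxE.
apply/esym/eqP; rewrite eqEdim; apply/andP; split.
  apply/subvP => _ /colspanP[x ->].
  by rewrite orthv_colspan !mulmxA F0 mul0mx.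
rewrite (dim_colspan (injmx_JF Fi)).
have := dim_orthv (@conjcK R) (@complex_definite R) (colspan F).
by rewrite (dim_colspan Fi) => /addnI ->.
Qed.

Lemma Lag_colspan L : @Lag_h R n L ->
  exists2 F : 'M[C]_(n + n, n), injmx F & L = colspan F.
Proof.
rewrite /Lag_h /= JmxE => LE; apply: colspan_exists.
(* As [J] is injective, [L] and its orthogonal have the same dimension, and the two dimensions add
   up to [n + n]. *)
have := dim_orthv (@conjcK R) (@complex_definite R) L.
rewrite LE limg_dim_eq.
  by move=> E; apply: double_inj; rewrite -addnn E addnn.
apply/eqP; rewrite -subv0; apply/subvP => v; rewrite memv_cap memv_ker memv0 lfunE/=.
move=> /andP[_ /eqP /(congr1 (mulmx Jmx))]; rewrite JmxK mulmx0.
by move=> /eqP; rewrite oppr_eq0.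
Qed.

(** Its span is the graph of [T] seen as a map from [Lambda I] to the orthogonal complement
    [J (Lambda I)]. *)
Definition graph_frame I T : 'M[C]_(n + n, n) := BI I + CI I *m T.

Lemma BI_gr I T : adj (BI I) *m graph_frame I T = 1%:M.
Proof. by rewrite mulmxDr BI_BI mulmxA BI_CI mul0mx addr0. Qed.

Lemma CI_gr I T : adj (CI I) *m graph_frame I T = T.
Proof. by rewrite mulmxDr CI_BI mulmxA CI_CI mul1mx add0r. Qed.

Lemma injmx_gr I T : injmx (graph_frame I T).
Proof. by apply: (@injmx_left _ _ (adj (BI I))); rewrite BI_gr unitmx1. Qed.

Lemma Lag_gr I T : Lag_h (colspan (graph_frame I T)) <-> adj T = T.
Proof.
have E : adj (graph_frame I T) *m Jmx *m graph_frame I T = adj T - T.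
  rewrite -mulmxA {2}/graph_frame mulmxDr (mulmxA Jmx) Jmx_BI Jmx_CI mulNmx mulmxBr.
  have -> : adj (graph_frame I T) *m CI I = adj T.
    by rewrite -[LHS](adjmxK (@conjcK R)) adjmxM (adjmxK (@conjcK R)) CI_gr.
  rewrite mulmxA (_ : adj (graph_frame I T) *m BI I = 1%:M) ?mul1mx//.
  by rewrite -[LHS](adjmxK (@conjcK R)) adjmxM (adjmxK (@conjcK R)) BI_gr adjmx1.
split=> [/(Lag_frame (@injmx_gr I T))|TT].
  by rewrite E => /eqP; rewrite subr_eq0 => /eqP.
by apply/(Lag_frame (@injmx_gr I T)); rewrite E TT subrr.
Qed.

(** Right multiplication by the inverse of [adj (BI I) *m F] normalises the component along
    [Lambda I] to the identity; the other component becomes the matrix of the graph. *)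
Lemma colspan_gr I F : adj (BI I) *m F \in unitmx ->
  colspan F = colspan (graph_frame I (adj (CI I) *m F *m invmx (adj (BI I) *m F))).
Proof.
move=> Xu; rewrite -(colspan_mulr (graph_frame I _) Xu); congr colspan.
rewrite mulmxDl -(mulmxA (CI I)) mulmxKV// !mulmxA -mulmxDl.
by rewrite BI_CI_sum mul1mx.
Qed.

End LagrangianFrames.

(** * Real coordinates on Hermitian matrices *)

Section HermitianCoordinates.
Variables (R : realType) (n : nat).
Local Notation C := R[i].
Local Notation M := 'M[R]_n.
Local Notation adj := (adjmx (@conjc R)).

(* The Hermitian matrix whose entries have their real parts stored in the upper
   triangle of [A], and their imaginary parts in the strict lower triangle. *)
Definition herm (A : M) : 'M[C]_n := \matrix_(i, j)
  if (i < j)%N then (A i j +i* A j i)%C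
  else if (j < i)%N then (A j i +i* - A i j)%C else (A i i)%:C%C.

Definition hcoords (T : 'M[C]_n) : M :=
  \matrix_(i, j) if (i <= j)%N then complex.Re (T i j) else complex.Im (T j i).

Lemma herm_adj A : adj (herm A) = herm A.
Proof.
apply/matrixP => i j; rewrite adjmxE !mxE; case: (ltngtP i j) => [||/val_inj ->] /=.
- by rewrite opprK.
- by [].
- by rewrite oppr0.
Qed.

Lemma hermK : cancel herm hcoords.
Proof.
move=> A; apply/matrixP => i j; rewrite !mxE; case: (ltngtP i j) => [||/val_inj ->] //=.
Qed.

Lemma hcoordsK T : adj T = T -> herm (hcoords T) = T.
Proof.
move=> TT; have TE i j : T j i = conjc (T i j) by rewrite -[in LHS]TT adjmxE.
apply/matrixP => i j; rewrite !mxE; case: (ltngtP i j) => [||/val_inj ->] /=.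
- by case: (T i j).
- by rewrite (TE j i); case: (T j i).
- rewrite leqnn; have := TE j j; case: (T j j) => a b [] /eqP.
  by rewrite eq_sym -subr_eq0 -opprD oppr_eq0 -mulr2n mulrn_eq0/= => /eqP ->.
Qed.

Lemma hermD A B : herm (A + B) = herm A + herm B.
Proof.
apply/matrixP => i j; rewrite !mxE; case: ltngtP => _; apply/eqP; rewrite eq_complex/=;
  by rewrite ?opprD ?addr0 !eqxx.
Qed.

Lemma herm0 : herm 0 = 0.
Proof.
apply/matrixP => i j; rewrite !mxE.
by case: ltngtP => _; apply/eqP; rewrite eq_complex/= ?oppr0 !eqxx.
Qed.

Definition weighted (s : 'I_n -> 'I_n -> R) (A : M) : M := \matrix_(i, j) (s i j * A i j).

Lemma herm_weighted s A i j : (forall i j, s i j = s j i) ->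
  herm (weighted s A) i j = (s i j)%:C%C * herm A i j.
Proof.
move=> ss; rewrite !mxE; case: (ltngtP i j) => [||/val_inj ->];
  by move=> *; apply/eqP; rewrite eq_complex/= ?(ss j i) ?mulrN ?mul0r ?mulr0
     ?oppr0 ?subr0 ?addr0 !eqxx.
Qed.

Lemma supp_herm (Q : 'I_n -> 'I_n -> bool) A : (forall i j, Q i j = Q j i) ->
  (forall i j, ~~ Q i j -> herm A i j = 0) -> supp Q A.
Proof.
move=> QC A0 i j ij; have := A0 _ _ ij; have := A0 j i; rewrite QC => /(_ ij).
rewrite !mxE; case: (ltngtP i j) => [||/val_inj ->] _ => [_ [->]|[_ +] _|[->]] //.
Qed.

Lemma herm_alg (T : Type) (A Nz : (T -> R) -> Prop) (AP : funalg A Nz) (f : T -> M) :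
  (forall i j, A (fun x => f x i j)) -> mxalg A (fun x => herm (f x)).
Proof.
move=> fA i j; split; case: (ltngtP i j) => ij.
- rewrite (_ : (fun x : T => _) = fun x => f x i j)//.
  by apply/funext => x; rewrite mxE ij.
- rewrite (_ : (fun x : T => _) = fun x => f x j i)//.
  by apply/funext => x; rewrite mxE ltnNge ltnW//= ij.
- rewrite (_ : (fun x : T => _) = fun x => f x i i)//.
  by apply/funext => x; rewrite mxE (val_inj ij) ltnn.
- rewrite (_ : (fun x : T => _) = fun x => f x j i)//.
  by apply/funext => x; rewrite mxE ij.
- rewrite (_ : (fun x : T => _) = fun x => - f x i j); first exact: (funalgN AP).
  by apply/funext => x; rewrite mxE ltnNge ltnW//= ij.
- rewrite (_ : (fun x : T => _) = fun=> 0); first exact: (funalg_cst AP).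
  by apply/funext => x; rewrite mxE (val_inj ij) ltnn.
Qed.

Lemma hcoords_alg (T : Type) (A : (T -> R) -> Prop) (F : T -> 'M[C]_n) :
  mxalg A F -> forall i j, A (fun x => hcoords (F x) i j).
Proof.
move=> FA i j; case: (boolP (i <= j)%N) => ij.
  rewrite (_ : (fun x : T => _) = fun x => complex.Re (F x i j)); first exact: (FA i j).1.
  by apply/funext => x; rewrite mxE ij.
rewrite (_ : (fun x : T => _) = fun x => complex.Im (F x j i)); first exact: (FA j i).2.
by apply/funext => x; rewrite mxE (negPf ij).
Qed.

End HermitianCoordinates.

(** * Rational charts of the Lagrangian Grassmannian *)

Section LagrangianCharts.
Variables (R : realType) (n : nat).
Local Notation C := R[i].
Local Notation M := 'M[R]_n.
Local Notation m := (n + n)%N.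
Local Notation V := 'cV[R]_(m * m + m * m).
Local Notation adj := (adjmx (@conjc R)).
Implicit Types (I : {set 'I_n}) (F : 'M[C]_(m, n)).

Definition lag_phi I (A : M) : V := emb (colspan (graph_frame I (herm A))).

(* If [P] is the projection onto the graph of [T] in the chart of [I], then
   [chart_num I P = T (1 + T* T)^-1] and [chart_den I P = (1 + T* T)^-1]. *)
Definition chart_num I (P : 'M[C]_m) : 'M[C]_n := adj (CI R I) *m P *m BI R I.
Definition chart_den I (P : 'M[C]_m) : 'M[C]_n := adj (BI R I) *m P *m BI R I.

Definition lag_rho I (v : V) : M :=
  hcoords (chart_num I (unrealify v) *m detinv (chart_den I (unrealify v))).

(** For a Lagrangian [L], the condition says that [L] meets [J (Lambda I)] only at 0. It is imposed
    on every matrix, so as to define an open set of the ambient space. *)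
Definition lag_dom I : set V :=
  [set v | cnorm2 (\det (chart_den I (unrealify v))) != 0].

Lemma domE I v : lag_dom I v <-> chart_den I (unrealify v) \in unitmx.
Proof. by rewrite /lag_dom/= cnorm2_eq0 unitmxE unitfE. Qed.

Lemma chart_den_alg (T : Type) (A Nz : (T -> R) -> Prop) (AP : funalg A Nz)
    (B D : 'M[C]_(m, n)) (f : T -> V) : (forall i, A (fun x => f x i 0)) ->
  mxalg A (fun x => adj D *m unrealify (f x) *m B).
Proof.
move=> fA; apply: (mxalgM AP); last exact: (mxalg_cst AP).
by apply: (mxalgM AP); [exact: (mxalg_cst AP)|exact: unrealify_alg].
Qed.

Lemma cnorm2_alg (T : Type) (A Nz : (T -> R) -> Prop) (AP : funalg A Nz) (f : T -> C) :
  calg A f -> A (fun x => cnorm2 (f x)).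
Proof. by move=> [f1 f2]; apply: (funalgD AP); exact: (funalgM AP). Qed.

Lemma open_dom I : open (lag_dom I).
Proof.
pose f (v : V) : R := cnorm2 (\det (chart_den I (unrealify v))).
have fr : ratfun setT f.
  apply: (cnorm2_alg (rat_funalg _)); apply: (calg_det (rat_funalg _)).
  by apply: (chart_den_alg (rat_funalg _)) => i; exact: rat_mxentry.
have -> : lag_dom I = f @^-1` [set x | x != 0] by [].
apply: open_comp; first by move=> v _; exact: (rat_continuous openT fr Logic.I).
exact: open_neq.
Qed.

Lemma emb_inj : injective (@emb R n).
Proof.
move=> L L' LL'; apply: (orthproj_inj (@complex_definite R)).
exact: (can_inj (@realifyK R m) LL').
Qed.

Lemma unrealify_emb F : injmx F -> unrealify (emb (colspan F)) = frameproj F.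
Proof. by move=> Fi; rewrite /emb realifyK frameprojE. Qed.

Lemma chart_denE I F : injmx F -> chart_den I (unrealify (emb (colspan F))) =
  adj (BI R I) *m F *m invmx (adj F *m F) *m adj (adj (BI R I) *m F).
Proof.
move=> Fi; rewrite unrealify_emb// /chart_den /frameproj detinvE ?adj_scalar//.
by rewrite adjmxM (adjmxK (@conjcK R)) !mulmxA.
Qed.

Lemma dom_emb I F : injmx F ->
  lag_dom I (emb (colspan F)) <-> adj (BI R I) *m F \in unitmx.
Proof.
move=> Fi; have E := unitmx_congr (@conjc R) (adj (BI R I) *m F) (adj_scalar Fi).
by rewrite -(chart_denE I Fi) in E; split=> [/domE|Fu]; [rewrite E|apply/domE; rewrite E].
Qed.

Lemma injmx_unit k (A : 'M[C]_k) : injmx A -> A \in unitmx.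
Proof. by move=> /adj_scalar; rewrite unitmx_mul => /andP[]. Qed.

Lemma phi_chart I : chart (lag_phi I) (lag_rho I) (lag_dom I).
Proof.
split=> [||i j|a|a]; first exact: open_dom.
- move=> i j; rewrite ord1.
  rewrite (_ : (fun x => _) =
    fun A : M => realify (frameproj (graph_frame I (herm A))) i 0); last first.
    by apply/funext => A; rewrite /lag_phi /emb frameprojE//; exact: injmx_gr.
  apply: realify_alg.
  have gA : mxalg (ratfun [set: M]) (fun A => graph_frame I (herm A)).
    apply: (mxalgD (rat_funalg _)); first exact: (mxalg_cst (rat_funalg _)).
    apply: (mxalgM (rat_funalg _)); first exact: (mxalg_cst (rat_funalg _)).
    by apply: (herm_alg (rat_funalg _)) => k l; exact: rat_mxentry.
  have gA' := mxalg_adj (rat_funalg _) gA.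
  apply: (mxalgM (rat_funalg _)) => //; apply: (mxalgM (rat_funalg _)) => //.
  apply: (mxalg_detinv (rat_funalg _)); first exact: (mxalgM (rat_funalg _)).
  move=> A _; rewrite cnorm2_eq0 -unitfE -unitmxE adj_scalar//.
  exact: injmx_gr.
- have uA (B : 'M[C]_(m, n)) : mxalg (ratfun (lag_dom I)) (fun v => adj B *m unrealify v *m BI R I).
    by apply: (chart_den_alg (rat_funalg _)) => k; exact: rat_mxentry.
  apply: hcoords_alg; apply: (mxalgM (rat_funalg _)); first exact: uA.
  by apply: (mxalg_detinv (rat_funalg _)); first exact: uA.
- by apply/dom_emb; [exact: injmx_gr|rewrite BI_gr unitmx1].
rewrite /lag_rho.
have du : lag_dom I (lag_phi I a) by apply/dom_emb; [exact: injmx_gr|rewrite BI_gr unitmx1].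
rewrite detinvE; last exact/domE.
rewrite chart_denE; last exact: injmx_gr.
rewrite BI_gr mul1mx adjmx1 mulmx1 invmxK /chart_num unrealify_emb; last exact: injmx_gr.
rewrite /frameproj detinvE; last by apply: adj_scalar; exact: injmx_gr.
have gi := @injmx_gr R n I (herm a); have B1 : adj (graph_frame I (herm a)) *m BI R I = 1%:M.
  by rewrite -[LHS](adjmxK (@conjcK R)) adjmxM (adjmxK (@conjcK R)) BI_gr adjmx1.
rewrite !mulmxA CI_gr -(mulmxA _ _ (BI R I)) B1 mulmx1 -(mulmxA _ _ (graph_frame I _)).
by rewrite mulmxKV ?hermK//; exact: adj_scalar.
Qed.

Lemma Lag_phi I a : (@emb R n @` @Lag_h R n) (lag_phi I a).
Proof. by exists (colspan (graph_frame I (herm a))) => //; apply/Lag_gr; exact: herm_adj. Qed.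

Lemma Lag_chart I F : injmx F -> Lag_h (colspan F) ->
  adj (BI R I) *m F \in unitmx -> exists a, colspan F = colspan (graph_frame I (herm a)).
Proof.
move=> Fi + Fu; rewrite (colspan_gr Fu) => /Lag_gr TT.
by eexists (hcoords _); rewrite hcoordsK.
Qed.

Lemma Lag_dom I p : (@emb R n @` @Lag_h R n) p -> lag_dom I p -> exists a, p = lag_phi I a.
Proof.
move=> [L LL <-]; have [F Fi LE] := Lag_colspan LL; rewrite LE in LL *.
by move=> /(dom_emb _ Fi)/(Lag_chart Fi LL)[a ->]; exists a.
Qed.

End LagrangianCharts.

(** * The flow and its cells *)

Section DiagonalAction.
Variables (R : realType) (n : nat).
Local Notation C := R[i].
Implicit Types (I : {set 'I_n}) (u v : 'rV[C]_n).

Lemma diag_dmx u v (P : pred 'I_n) : (forall i, P i -> u 0 i = v 0 i) ->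
  diag_mx u *m dmx R P = dmx R P *m diag_mx v.
Proof.
move=> uv; rewrite !mulmx_diag; congr diag_mx; apply/rowP => i; rewrite !mxE.
by have [/uv ->|_] := boolP (P i); rewrite ?mulr1 ?mul1r// mulr0 mul0r.
Qed.

Lemma diag_BI u v I : diag_mx (row_mx u v) *m BI R I =
  BI R I *m diag_mx (\row_i if i \in I then u 0 i else v 0 i).
Proof.
set w := \row__ _; rewrite diag_mx_row mul_block_col mul_col_mx !mul0mx addr0 add0r.
rewrite (diag_dmx (P := fun i => i \in I) (v := w)); last first.
  by move=> i iI; rewrite mxE iI.
rewrite (diag_dmx (P := fun i => i \notin I) (v := w))// => i /negPf iI.
by rewrite mxE iI.
Qed.

Lemma diag_CI u v I : diag_mx (row_mx u v) *m CI R I =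
  CI R I *m diag_mx (\row_i if i \in I then v 0 i else u 0 i).
Proof.
set w := \row__ _.
rewrite diag_mx_row mul_block_col mul_col_mx !mul0mx addr0 add0r mulmxN mulNmx.
rewrite (diag_dmx (P := fun i => i \notin I) (v := w)); last first.
  by move=> i /negPf iI; rewrite mxE iI.
by rewrite (diag_dmx (P := fun i => i \in I) (v := w))// => i iI; rewrite mxE iI.
Qed.

(** Here [diag_mx d] is the action on the frame of [Lambda I]; standing on the right, it does not
    change the span, and its inverse [diag_mx e] enters the new graph matrix. *)
Lemma diag_gr u v I (T : 'M[C]_n) (d e : 'rV[C]_n) :
  (forall i, d 0 i = if i \in I then u 0 i else v 0 i) ->
  (forall i, e 0 i * (if i \in I then u 0 i else v 0 i) = 1) ->
  diag_mx (row_mx u v) *m graph_frame I T = graph_frame I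
   (diag_mx (\row_i if i \in I then v 0 i else u 0 i) *m T *m diag_mx e) *m diag_mx d.
Proof.
move=> dE eE; have ed : diag_mx e *m diag_mx d = 1%:M.
  rewrite mulmx_diag (_ : (\row_i _) = const_mx 1) ?diag_const_mx//.
  by apply/rowP => i; rewrite !mxE dE eE.
rewrite /graph_frame mulmxDr mulmxDl diag_BI mulmxA diag_CI -!mulmxA ed mulmx1; congr (_ + _).
by congr (_ *m diag_mx _); apply/rowP => i; rewrite mxE dE.
Qed.

End DiagonalAction.

Section Flow.
Variables (R : realType) (n : nat) (alpha : 'I_n -> R).
Local Notation C := R[i].
Local Notation M := 'M[R]_n.
Local Notation m := (n + n)%N.
Local Notation adj := (adjmx (@conjc R)).
Implicit Types (I K : {set 'I_n}).

Lemma expmx_diag k (d : 'rV[R]_k) t :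
  expmx (t *: diag_mx d) = diag_mx (\row_i expR (t * d 0 i)).
Proof.
have powE p : (t *: diag_mx d) ^+ p = diag_mx (\row_i (t * d 0 i) ^+ p).
  elim: p => [|p IHp].
    rewrite expr0 (_ : (\row_i _) = const_mx 1) ?diag_const_mx//.
    by apply/rowP => i; rewrite !mxE expr0.
  rewrite exprS IHp -[_ * _]/(_ *m _) -scalemxAl mulmx_diag -[t *: diag_mx _]/(t *: diag_mx _).
  apply/matrixP => i j; rewrite !mxE mulrnAr; congr (_ *+ _).
  by rewrite exprS mulrA.
apply/matrixP => i j; rewrite !mxE; have [<-|ij] := eqVneq i j.
  rewrite mulr1n /expR; congr (limn (series _)); apply/funext => p.
  by rewrite powE !mxE eqxx mulr1n.
rewrite mulr0n (_ : series _ = fun=> 0) ?lim_cst//; apply/funext => p.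
by rewrite /series/= big1// => q _; rewrite powE !mxE (negPf ij) mulr0n mul0r.
Qed.

Definition Em (t : R) : 'M[C]_m := map_mx (real_complex R) (expmx (t *: Ahat alpha)).

Lemma EmE t : Em t = diag_mx (row_mx (\row_i (expR (t * alpha i))%:C%C)
   (\row_i (expR (- (t * alpha i)))%:C%C)).
Proof.
rewrite /Em /Ahat expmx_diag map_diag_mx; congr diag_mx; apply/rowP => i; rewrite !mxE.
by case: split_ordP => j _; rewrite !mxE// mulrN.
Qed.

Lemma Em_inv t : Em (- t) *m Em t = 1%:M.
Proof.
rewrite !EmE mulmx_diag (_ : (\row_i _) = const_mx 1) ?diag_const_mx//.
apply/rowP => i; rewrite !mxE; case: split_ordP => j _; rewrite !mxE -rmorphM/= -expRD.
  by rewrite mulNr addNr expR0 rmorph1.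
by rewrite mulNr opprK addrN expR0 rmorph1.
Qed.

Lemma Psi_colspan t (F : 'M[C]_(m, n)) :
  Psi alpha t (colspan F) = colspan (Em t *m F).
Proof. exact: colspan_limg. Qed.

(** The eigenvalue of [Ahat] on the column [i] of [BI I]; the one on the column [i] of [CI I] is its
    opposite. Hence the entry [T i j] evolves at the rate [- (wt I i + wt I j)]. *)
Definition wt I i := if i \in I then alpha i else - alpha i.

Definition EI I t : 'M[C]_n := diag_mx (\row_i (expR (t * wt I i))%:C%C).

Lemma EI_inv I t : EI I (- t) *m EI I t = 1%:M.
Proof.
rewrite mulmx_diag (_ : (\row_i _) = const_mx 1) ?diag_const_mx//.
apply/rowP => i; rewrite !mxE -rmorphM/= -expRD mulNr addNr expR0.
by rewrite rmorph1.
Qed.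

Lemma EI_unit I t : EI I t \in unitmx.
Proof. by have [] := mulmx1_unit (EI_inv I t). Qed.

Lemma Em_BI I t : Em t *m BI R I = BI R I *m EI I t.
Proof.
rewrite EmE diag_BI; congr (_ *m diag_mx _); apply/rowP => i; rewrite !mxE /wt.
by case: ifP; rewrite // mulrN.
Qed.

Lemma Em_CI I t : Em t *m CI R I = CI R I *m EI I (- t).
Proof.
rewrite EmE diag_CI; congr (_ *m diag_mx _); apply/rowP => i; rewrite !mxE /wt.
by case: ifP => _; rewrite ?mulrN mulNr ?opprK.
Qed.

Lemma Em_gr I t T :
  Em t *m graph_frame I T = graph_frame I (EI I (- t) *m T *m EI I (- t)) *m EI I t.
Proof.
by rewrite /graph_frame mulmxDr mulmxDl Em_BI mulmxA Em_CI -!mulmxA EI_inv mulmx1.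
Qed.

Lemma BI_Em I t : adj (BI R I) *m Em t = EI I t *m adj (BI R I).
Proof.
have aE k (d : 'rV[R]_k) : adj (diag_mx (map_mx (real_complex R) d)) =
    diag_mx (map_mx (real_complex R) d).
  apply/matrixP => i j; rewrite adjmxE !mxE eq_sym; case: eqVneq => [->|_].
    by rewrite !mulr1n; exact: conjc_real.
  by rewrite !mulr0n rmorph0.
have -> : EI I t = adj (EI I t).
  rewrite /EI (_ : (\row_i _) = map_mx (real_complex R) (\row_i expR (t * wt I i))) ?aE//.
  by apply/rowP => i; rewrite !mxE.
rewrite -adjmxM -Em_BI adjmxM; congr (_ *m _).
by rewrite /Em /Ahat expmx_diag map_diag_mx aE.
Qed.

Definition flow I t (A : M) : M :=
  weighted (fun i j => expR (- (t * (wt I i + wt I j)))) A.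

Lemma herm_flow I t A : EI I (- t) *m herm A *m EI I (- t) = herm (flow I t A).
Proof.
apply/matrixP => i j; rewrite herm_weighted; last by move=> k l; rewrite addrC.
rewrite mul_mx_diag mul_diag_mx [LHS]mxE [X in X * _]mxE.
rewrite (mulrAC _ (herm A i j)) !mxE -rmorphM/= -expRD.
by rewrite -mulrDr mulNr.
Qed.

Lemma Psi_gr I t A :
  Psi alpha t (colspan (graph_frame I (herm A))) = colspan (graph_frame I (herm (flow I t A))).
Proof. by rewrite Psi_colspan Em_gr (colspan_mulr _ (EI_unit _ _)) herm_flow. Qed.

Lemma Lambda_colspan I : Lambda R I = colspan (BI R I).
Proof.
have colE i : BI R I *m delta_mx i 0 = if i \in I then ebf R i else fbf R i.
  rewrite -colE col_col_mx; apply/matrixP => k l; rewrite ord1.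
  case: (split_ordP k) => p ->; rewrite ?(col_mxEu, col_mxEd).
    rewrite !mxE; case: ifP => iI; rewrite ?(col_mxEu, col_mxEd) !mxE.
      by case: eqVneq => [->|]; rewrite ?iI// mulr0n.
    by case: eqVneq => [->|]; rewrite ?iI// ?mulr0n// mul0rn.
  rewrite !mxE; case: ifP => iI; rewrite ?(col_mxEu, col_mxEd) !mxE.
    by case: eqVneq => [->|]; rewrite ?iI// ?mulr0n// mul0rn.
  by case: eqVneq => [->|]; rewrite ?iI// mulr0n.
apply/eqP; rewrite eqEsubv; apply/andP; split.
  rewrite subv_add; apply/andP; split; apply/subv_sumP => i iI; rewrite -memvE.
    by apply/colspanP; exists (delta_mx i 0); rewrite colE iI.
  apply/colspanP; exists (delta_mx i 0); rewrite colE.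
  by rewrite finset.inE in iI; rewrite (negPf iI).
apply/subvP => _ /colspanP[x ->].
have -> : x = \sum_i x i 0 *: delta_mx i 0.
  by rewrite {1}[x]matrix_sum_delta; apply: eq_bigr => i _; rewrite big_ord1.
rewrite mulmx_sumr; apply: memv_suml => i _; rewrite -scalemxAr; apply: memvZ.
rewrite colE; case: ifP => iI.
  apply: (subvP (addvSl _ _)); apply: (subvP (sumv_sup i iI (subvv _))).
  exact: memv_line.
have iI' : i \in ~: I by rewrite finset.inE iI.
apply: (subvP (addvSr _ _)); apply: (subvP (sumv_sup i iI' (subvv _))).
exact: memv_line.
Qed.

Lemma emb_Lambda I : emb (Lambda R I) = lag_phi I 0.
Proof. by rewrite Lambda_colspan /lag_phi herm0 /graph_frame mulmx0 addr0. Qed.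

End Flow.

Section Cells.
Variables (R : realType) (n : nat) (alpha : 'I_n -> R).
Local Notation C := R[i].
Local Notation M := 'M[R]_n.
Local Notation m := (n + n)%N.
Local Notation adj := (adjmx (@conjc R)).
Local Notation wt := (wt alpha).
Local Notation flow := (flow alpha).
Implicit Types (I K : {set 'I_n}).

(** The sign [s] is 1 for [Wplus] and -1 for [Wminus], so that both kinds of cells are treated
    together. *)
Lemma flow_cvg I (s : R) (A : M) :
  (forall i j, A i j != 0 -> 0 < s * (wt I i + wt I j)) ->
  flow I (s * t) A @[t --> +oo] --> (0 : M).
Proof.
move=> AQ; apply/cvg_mxP => i j.
rewrite (_ : (fun x : R => _) = fun t : R =>
    expR (- (t * (s * (wt I i + wt I j)))) * A i j); last first.
  by apply/funext => t; rewrite !mxE (mulrC s t) mulrA.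
have [->|Aij] := eqVneq (A i j) 0.
  by rewrite mxE; under eq_fun do rewrite mulr0; exact: cvg_cst.
rewrite mxE -[0 in X in _ --> X](mul0r (A i j)); apply: (@cvgM R); last exact: cvg_cst.
apply: (cvg_comp _ (fun x => expR (- x)) _ (@cvgr_expR R)).
by apply: gt0_cvgMly; [exact: AQ|exact: cvg_id].
Qed.

(** Such an entry is multiplied by a factor at least 1 at all times [t >= 0], so it can tend to 0
    only if it is 0. *)
Lemma cvg_flow_supp I (s : R) (A : M) i j :
  s * (wt I i + wt I j) < 0 -> flow I (s * t) A @[t --> +oo] --> (0 : M) -> A i j = 0.
Proof.
move=> c0 /cvg_mxP/(_ i j); rewrite mxE => A0; apply/eqP/negP => /negP Aij.
have : \forall t \near +oo, `|flow I (s * t) A i j| < `|A i j|.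
  move/cvgrPdist_lt : A0 => /(_ `|A i j|); rewrite normr_gt0 => /(_ Aij).
  by apply: filterS => t; rewrite sub0r normrN.
have t0 : \forall t \near +oo, (0 : R) <= t by exact: nbhs_pinfty_ge.
move=> /(filterI t0)/filter_ex[t [{}t0]].
rewrite mxE normrM -[X in _ < X]mul1r ltNge => /negP[].
rewrite ler_pM2r ?normr_gt0// ger0_norm ?expR_ge0//.
rewrite -[X in X <= _]expR0 ler_expR oppr_ge0 (mulrC s) -mulrA.
by rewrite mulr_ge0_le0// ltW.
Qed.

Lemma unitmx_mulr (K : fieldType) k (A B : 'M[K]_k) : A *m B \in unitmx -> B \in unitmx.
Proof. by rewrite unitmx_mul => /andP[]. Qed.

(** A trajectory that converges to [Lambda I] is in the open chart domain at some time. The flow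
    preserves [Lambda I] and its orthogonal, hence the domain as well: [L] was in the chart from the
    start, and there the flow acts on each entry separately. *)
Lemma cell_chart (s : R) (Q : 'I_n -> 'I_n -> bool) I L :
  (forall i j, Q i j = Q j i) ->
  (forall i j, Q i j -> 0 < s * (wt I i + wt I j)) ->
  (forall i j, ~~ Q i j -> s * (wt I i + wt I j) < 0) ->
  (Lag_h L /\ emb (Psi alpha (s * t) L) @[t --> +oo] --> emb (Lambda R I)) <->
  exists2 A, supp Q A & L = colspan (graph_frame I (herm A)).
Proof.
move=> QC Qpos Qneg; rewrite emb_Lambda; split=> [[LL Lcvg]|[A AQ ->]]; last first.
  split; first by apply/Lag_gr; exact: herm_adj.
  under eq_fun do rewrite Psi_gr.
  apply: (cvg_comp _ (lag_phi I)).
    apply: flow_cvg => i j Aij; apply: Qpos; apply: contraNT Aij => Qij.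
    by rewrite AQ.
  exact: (mxrat_continuous openT (chart_phi (phi_chart R I))).
have [F Fi LE] := Lag_colspan LL; rewrite LE in LL Lcvg *.
have [_] := chart_cvg (phi_chart R I) Lcvg.
move=> /filter_ex[t]; rewrite Psi_colspan => /dom_emb Fu.
have EF : injmx (Em alpha (s * t) *m F).
  move=> x; rewrite -mulmxA => Ex; apply: Fi.
  by rewrite -[F *m x]mul1mx -(Em_inv alpha (s * t)) -mulmxA Ex mulmx0.
have {}Fu := Fu EF; rewrite mulmxA BI_Em -mulmxA in Fu.
have [A FA] := Lag_chart Fi LL (unitmx_mulr Fu); exists A => //.
move: Lcvg; rewrite FA; under eq_fun do rewrite Psi_gr; move=> Lcvg i j /Qneg c0.
have [rc _] := chart_cvg (phi_chart R I) Lcvg.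
apply: (cvg_flow_supp c0); apply: cvg_trans rc; apply: near_eq_cvg.
by near=> t'; rewrite (chartK (phi_chart R I)).
Unshelve. all: by end_near. Qed.

(* The factor acting on the larger of the two indices prevails. *)
Definition ordmax2 (i j : 'I_n) := if (i <= j)%N then j else i.

Lemma omaxC i j : ordmax2 i j = ordmax2 j i.
Proof. by rewrite /ordmax2; case: ltngtP => // /val_inj. Qed.

Hypothesis alpha_gt0 : forall i, 0 < alpha i.
Hypothesis alpha_incr : forall i j : 'I_n, (i < j)%N -> alpha i < alpha j.

(** Off the diagonal, the eigenvalue of the larger index is strictly larger in absolute value; on
    the diagonal, the two are equal and add up. In particular no rate vanishes. *)
Lemma wt_omax I i j :
  if ordmax2 i j \in I then 0 < wt I i + wt I j else wt I i + wt I j < 0.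
Proof.
wlog ij : i j / (i <= j)%N => [wlg|].
  by have [/wlg//|/ltnW/wlg] := leqP i j; rewrite omaxC addrC.
rewrite /ordmax2 ij /wt; have i0 := alpha_gt0 i; have j0 := alpha_gt0 j.
have : alpha i < alpha j \/ i = j.
  by move: ij; rewrite leq_eqVlt => /orP[/eqP/val_inj ->|/alpha_incr]; [right|left].
case=> [aij|->]; last by case: (j \in I); lra.
by case: (i \in I); case: (j \in I); lra.
Qed.

Lemma WminusE I L : Wminus alpha I L <->
  exists2 A, supp (fun i j => ordmax2 i j \notin I) A & L = colspan (graph_frame I (herm A)).
Proof.
have -> : Wminus alpha I L = (Lag_h L /\
    emb (Psi alpha (-1 * t) L) @[t --> +oo] --> emb (Lambda R I)).
  by rewrite /Wminus /=; under [in RHS]eq_fun do rewrite mulN1r.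
apply: cell_chart => i j; first by rewrite omaxC.
  by move=> ijI; have := wt_omax I i j; rewrite (negPf ijI) mulN1r oppr_gt0.
by move=> /negbNE ijI; have := wt_omax I i j; rewrite ijI mulN1r oppr_lt0.
Qed.

Lemma WplusE I L : Wplus alpha I L <->
  exists2 A, supp (fun i j => ordmax2 i j \in I) A & L = colspan (graph_frame I (herm A)).
Proof.
have -> : Wplus alpha I L = (Lag_h L /\
    emb (Psi alpha (1 * t) L) @[t --> +oo] --> emb (Lambda R I)).
  by rewrite /Wplus /=; under [in RHS]eq_fun do rewrite mul1r.
apply: cell_chart => i j; first by rewrite omaxC.
  by move=> ijI; have := wt_omax I i j; rewrite ijI mul1r.
by move=> /negPf ijI; have := wt_omax I i j; rewrite ijI mul1r.
Qed.

Lemma emb_phi I (W : set {vspace 'cV[C]_m}) (Q : 'I_n -> 'I_n -> bool) :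
  (forall L, W L <-> exists2 A, supp Q A & L = colspan (graph_frame I (herm A))) ->
  forall p, (@emb R n @` W) p <-> exists2 A, supp Q A & p = lag_phi I A.
Proof.
move=> WE p; split=> [[L /WE[A AQ ->] <-]|[A AQ ->]]; first by exists A.
by exists (colspan (graph_frame I (herm A))) => //; apply/WE; exists A.
Qed.

End Cells.

(** * Shears and tori that preserve the cells *)

Section Translation.
Variables (R : realType) (n : nat) (alpha : 'I_n -> R).
Local Notation C := R[i].
Local Notation M := 'M[R]_n.
Local Notation m := (n + n)%N.
Local Notation adj := (adjmx (@conjc R)).
Implicit Types (I K : {set 'I_n}).

(** Injectivity of the frame is an open condition, seen on the Gram determinant; near [x0] the
    projection is thus given by its rational formula. *)
Lemma frame_cvg (T : topologicalType) (x0 : T) (F : T -> 'M[C]_(m, n)) :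
  mxalg (fun f : T -> R => f @ x0 --> f x0) F -> injmx (F x0) ->
  emb (colspan (F x)) @[x --> x0] --> emb (colspan (F x0)).
Proof.
move=> FA Fi; have AP : funalg (fun f : T -> R => f @ x0 --> f x0) (fun f => f x0 != 0).
  exact: cvg_funalg.
have FA' := mxalg_adj AP FA; have GA := mxalgM AP FA' FA.
have d0 : cnorm2 (\det (adj (F x0) *m F x0)) != 0.
  by rewrite cnorm2_eq0 -unitfE -unitmxE adj_scalar.
have Fxi : \forall x \near x0, injmx (F x).
  have dA := cnorm2_alg AP (calg_det AP GA).
  have : \forall x \near x0, cnorm2 (\det (adj (F x) *m F x)) != 0.
    have /dA : nbhs (cnorm2 (\det (adj (F x0) *m F x0))) [set x : R | x != 0].
      by apply: open_nbhs_nbhs; split; [exact: open_neq|exact: d0].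
    exact.
  apply: filterS => x /=; rewrite cnorm2_eq0 -unitfE -unitmxE.
  exact: injmx_left.
have P0 : realify (frameproj (F x)) @[x --> x0] --> realify (frameproj (F x0)).
  apply/cvg_mxP => i j; rewrite ord1.
  apply: (realify_alg (A := fun f : T -> R => f @ x0 --> f x0)).
  exact: (mxalgM AP (mxalgM AP FA (mxalg_detinv AP GA d0)) FA').
rewrite /emb frameprojE//; apply: cvg_trans P0; apply: near_eq_cvg.
by apply: filterS Fxi => x Fxi; rewrite frameprojE.
Qed.

(** A unipotent matrix that fixes [J (Lambda I)] pointwise and moves [Lambda I] to the graph of
    [S]. *)
Definition shear I (S : 'M[C]_n) : 'M[C]_m := 1%:M + CI R I *m S *m adj (BI R I).

Lemma shear_gr I S T : shear I S *m graph_frame I T = graph_frame I (T + S).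
Proof.
by rewrite mulmxDl mul1mx -!mulmxA BI_gr mulmx1 /graph_frame mulmxDr addrA.
Qed.

(** Conjugation by the flow rescales [S] exactly as it rescales chart coordinates, so the shears
    along [Wminus I] tend to the identity in backward time. *)
Lemma Em_shear I t S : Em alpha t *m shear I S =
  shear I (EI alpha I (- t) *m S *m EI alpha I (- t)) *m Em alpha t.
Proof.
rewrite /shear mulmxDr mulmxDl mulmx1 mul1mx; congr (_ + _).
rewrite -!mulmxA BI_Em !mulmxA Em_CI -(mulmxA _ (EI _ _ _) (EI _ _ t)) EI_inv.
by rewrite mulmx1.
Qed.

Lemma shear_cvg I K : emb (colspan (shear I (herm x.1) *m graph_frame K (herm x.2)))
  @[x --> ((0, 0) : M * M)] --> emb (Lambda R K).
Proof.
pose F (x : M * M) := shear I (herm x.1) *m graph_frame K (herm x.2).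
have F0 : F (0, 0) = BI R K.
  by rewrite /F /shear /graph_frame/= !herm0 !mulmx0 mul0mx !addr0 mul1mx.
rewrite Lambda_colspan -F0; apply: (frame_cvg (F := F)); last first.
  by rewrite F0 -[BI R K]addr0 -(mulmx0 _ (CI R K)); exact: injmx_gr.
pose A (f : M * M -> R) := f @ ((0, 0) : M * M) --> f (0, 0).
have AP : funalg A (fun f => f (0, 0) != 0) by exact: cvg_funalg.
have A1 : mxalg A (fun x => herm x.1).
  apply: (herm_alg AP) => i j.
  exact: (cvg_comp _ (fun A : M => A i j) (@cvg_fst _ _ _ _ _) (@coord_continuous _ _ _ i j _)).
have A2 : mxalg A (fun x => herm x.2).
  apply: (herm_alg AP) => i j.
  exact: (cvg_comp _ (fun A : M => A i j) (@cvg_snd _ _ _ _ _) (@coord_continuous _ _ _ i j _)).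
have cA k l (B : 'M[C]_(k, l)) : mxalg A (fun=> B) by exact: (mxalg_cst AP).
exact: (mxalgM AP (mxalgD AP (cA _ _ 1%:M) (mxalgM AP (mxalgM AP (cA _ _ (CI R I)) A1)
  (cA _ _ (adj (BI R I))))) (mxalgD AP (cA _ _ (BI R K)) (mxalgM AP (cA _ _ (CI R K)) A2))).
Qed.

Hypothesis alpha_gt0 : forall i, 0 < alpha i.
Hypothesis alpha_incr : forall i j : 'I_n, (i < j)%N -> alpha i < alpha j.

Lemma Wminus_phi I K a : (@emb R n @` Wminus alpha K) (lag_phi I a) ->
  exists2 A, supp (fun i j => ordmax2 i j \notin K) A &
    colspan (graph_frame I (herm a)) = colspan (graph_frame K (herm A)).
Proof. by move=> [L /(WminusE alpha_gt0 alpha_incr)[A AQ ->] /emb_inj <-]; exists A. Qed.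

Lemma flow_supp_cvg I A : supp (fun i j => ordmax2 i j \notin I) A ->
  flow alpha I (- t) A @[t --> +oo] --> (0 : M).
Proof.
move=> AQ; have := @flow_cvg _ _ alpha I (-1) A.
under eq_fun do rewrite mulN1r; apply => i j Aij.
have /negPf ijI : ordmax2 i j \notin I.
  by apply: contraTN isT => ijI; case/eqP: Aij; apply: AQ; rewrite negbK.
by have := wt_omax alpha_gt0 alpha_incr I i j; rewrite ijI mulN1r oppr_gt0.
Qed.

Lemma Wminus_translate I K a s : supp (fun i j => ordmax2 i j \notin I) s ->
  (@emb R n @` Wminus alpha K) (lag_phi I a) ->
  (@emb R n @` Wminus alpha K) (lag_phi I (a + s)).
Proof.
move=> sQ /Wminus_phi[A AQ aA].
exists (colspan (graph_frame I (herm (a + s)))); last exact: erefl.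
split; first by apply/Lag_gr; exact: herm_adj.
(* The translation is a shear in the chart of [I], while convergence to [Lambda K] is visible in the
   chart of [K]; the backward flow contracts the shear and the point at once. *)
have PsiE t : Psi alpha (- t) (colspan (graph_frame I (herm (a + s)))) =
    colspan (shear I (herm (flow alpha I (- t) s)) *m graph_frame K (herm (flow alpha K (- t) A))).
  have E : Em alpha (- t) *m (shear I (herm s) *m graph_frame K (herm A)) =
      shear I (herm (flow alpha I (- t) s)) *m graph_frame K (herm (flow alpha K (- t) A)) *m
      EI alpha K (- t).
    by rewrite mulmxA Em_shear -(mulmxA _ (Em _ _)) Em_gr mulmxA !herm_flow.
  rewrite hermD Psi_colspan -shear_gr -(colspan_limg _ (shear _ _ *m _)).
  rewrite -(colspan_limg (shear _ _)) aA (colspan_limg (shear _ _)) colspan_limg E.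
  by apply: colspan_mulr; exact: EI_unit.
under eq_fun do rewrite PsiE.
have xt : (flow alpha I (- t) s, flow alpha K (- t) A) @[t --> +oo] --> ((0, 0) : M * M).
  exact: cvg_pair (flow_supp_cvg sQ) (flow_supp_cvg AQ).
pose g (x : M * M) := emb (colspan (shear I (herm x.1) *m graph_frame K (herm x.2))).
exact: (cvg_comp (fun t => (flow alpha I (- t) s, flow alpha K (- t) A)) g xt (@shear_cvg I K)).
Qed.

(** The condition [u i * v i = c] says that the diagonal matrix multiplies the form of [J] by [c].
    It therefore preserves Lagrangians, and acts on the entries of every chart by real symmetric
    weights. *)
Lemma colspan_diag_herm J (u v : 'I_n -> R) c A :
  (forall i, u i * v i = c) -> c != 0 ->
  (linfun (mulmx (diag_mx (row_mx (\row_i (u i)%:C%C) (\row_i (v i)%:C%C))) : 'cV[C]_m -> 'cV[C]_m)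
    @: colspan (graph_frame J (herm A)))%VS =
  colspan (graph_frame J (herm (weighted (fun i j => c / ((if i \in J then u i else v i) *
    (if j \in J then u j else v j))) A))).
Proof.
move=> uv c0; pose d i := if i \in J then u i else v i.
have u0 i : u i != 0 by apply: contraNneq c0 => u0; rewrite -(uv i) u0 mul0r.
have v0 i : v i != 0 by apply: contraNneq c0 => v0; rewrite -(uv i) v0 mulr0.
have d0 i : d i != 0 by rewrite /d; case: ifP.
have dE i : (if i \in J then v i else u i) = c / d i.
  by rewrite /d -(uv i); case: ifP => _; [rewrite mulrAC mulfV// mul1r|rewrite mulfK].
pose dm : 'rV[C]_n := \row_i (d i)%:C%C; pose em : 'rV[C]_n := \row_i ((d i)^-1)%:C%C.
have em_dm : diag_mx em *m diag_mx dm = 1%:M.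
  rewrite mulmx_diag (_ : (\row_i _) = const_mx 1) ?diag_const_mx//.
  by apply/rowP => i; rewrite !mxE -rmorphM/= mulVf// rmorph1.
rewrite colspan_limg (@diag_gr _ _ _ _ _ _ dm em).
- have [_ du] := mulmx1_unit em_dm.
  rewrite (colspan_mulr _ du); congr (colspan (graph_frame J _)); apply/matrixP => i j.
  rewrite herm_weighted; last by move=> k l; rewrite [X in _ / X]mulrC.
  rewrite mul_mx_diag mul_diag_mx [LHS]mxE [X in X * _]mxE.
  rewrite (mulrAC _ (herm A i j)); congr (_ * _).
  rewrite !mxE -(fun_if (fun x : R => x%:C%C)) dE -rmorphM/=.
  by rewrite -/(d i) -/(d j) invfM mulrA.
- by move=> i; rewrite !mxE /d; case: ifP.
- move=> i; rewrite !mxE -(fun_if (fun x : R => x%:C%C)) -/(d i) -rmorphM/=.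
  by rewrite mulVf// rmorph1.
Qed.

Lemma Wminus_scale I K a c : 0 < c -> (@emb R n @` Wminus alpha K) (lag_phi I a) ->
  (@emb R n @` Wminus alpha K) (lag_phi I (c *: a)).
Proof.
move=> c0 /Wminus_phi[A AQ aA].
(* This torus fixes [BI I] and multiplies [CI I] by [c], and thus dilates the chart
   of [I]; it acts on the chart of [K] by rescaling the coordinates. *)
pose u i : R := if i \in I then 1 else c; pose v i : R := if i \in I then c else 1.
have uv i : u i * v i = c by rewrite /u /v; case: ifP; rewrite ?mulr1 ?mul1r.
have cn0 : c != 0 by rewrite gt_eqF.
have aI := @colspan_diag_herm I u v c a uv cn0.
have aK := @colspan_diag_herm K u v c A uv cn0.
rewrite aA aK in aI.
exists (colspan (graph_frame I (herm (c *: a)))); last exact: erefl.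
apply/(WminusE alpha_gt0 alpha_incr).
pose w (i j : 'I_n) := c / ((if i \in K then u i else v i) * (if j \in K then u j else v j)).
exists (weighted w A); first by move=> i j ij; rewrite /weighted mxE (AQ _ _ ij) mulr0.
rewrite [RHS]aI; congr (colspan (graph_frame I (herm _))).
apply/matrixP => i j; rewrite /weighted !mxE.
by rewrite /u /v; case: (i \in I); case: (j \in I); rewrite mul1r divr1.
Qed.

End Translation.

(** * The cells cover the Lagrangian Grassmannian *)

Section Cover.
Variables (R : realType) (n : nat).
Local Notation C := R[i].
Local Notation m := (n + n)%N.
Local Notation adj := (adjmx (@conjc R)).
Implicit Types (I K : {set 'I_n}).

Lemma dmx_entry (P : pred 'I_n) (w : 'cV[C]_n) i :
  (dmx R P *m w) i 0 = if P i then w i 0 else 0.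
Proof. by rewrite mul_diag_mx !mxE; case: (P i); rewrite ?mul1r ?mul0r. Qed.

(* A maximal independent set [I] of rows of [X = usubmx F] works: a vector of
   the kernel is killed by [X], so its image by [dsubmx F], which vanishes off
   [I], is orthogonal to the columns of [X]. *)
Lemma Lag_transverse (F : 'M[C]_(m, n)) : injmx F -> adj F *m Jmx R n *m F = 0 ->
  exists I, adj (BI R I) *m F \in unitmx.
Proof.
move=> Fi F0; pose X := usubmx F; pose Y := dsubmx F.
have FE : F = col_mx X Y by rewrite vsubmxK.
have XY : adj X *m Y = adj Y *m X.
  move: F0; rewrite -mulmxA {2}FE mul_block_col FE adj_col_mx.
  rewrite !mul0mx mulNmx !mul1mx add0r addr0 mul_row_col mulmxN => /eqP.
  by rewrite addrC subr_eq0 => /eqP.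
pose f := maxrankfun X; pose I : {set 'I_n} := f @: 'I_(\rank X); exists I.
apply: injmx_unit => x; rewrite FE adj_col_mx mul_row_col !dmx_adj mulmxDl -!mulmxA => Mx.
have Mxi i : if i \in I then (X *m x) i 0 = 0 else (Y *m x) i 0 = 0.
  have /matrixP/(_ i 0) := Mx; rewrite [X in X = _]mxE !dmx_entry [RHS]mxE.
  by case: ifP => _ /=; rewrite ?addr0 ?add0r.
have X0 : X *m x = 0.
  have /submxP[D XD] : (X <= rowsub f X)%MS by rewrite eq_maxrowsub.
  rewrite XD -mulmxA (_ : rowsub f X *m x = 0) ?mulmx0//.
  apply/matrixP => k j; rewrite ord1 mul_rowsub_mx [LHS]mxE [RHS]mxE.
  by have := Mxi (f k); rewrite imset_f.
have w0 : adj X *m (Y *m x) = 0 by rewrite mulmxA XY -mulmxA X0 mulmx0.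
pose w := Y *m x.
have wI i : i \notin I -> w i 0 = 0 by move=> /negPf iI; have := Mxi i; rewrite iI.
pose u : 'rV[C]_(\rank X) := \row_k conjc (w (f k) 0).
have u0 : u = 0.
  have /row_freeP[B XB] := maxrowsub_free X.
  rewrite -[u]mulmx1 -XB mulmxA (_ : u *m _ = 0) ?mul0mx//.
  transitivity (adj (adj X *m w)); last by rewrite w0 adjmx0.
  apply/rowP => j; rewrite adjmxM (adjmxK (@conjcK R)) [LHS]mxE [RHS]mxE.
  rewrite (bigID (fun i => i \in I))/= [X in _ = _ + X]big1 ?addr0; last first.
    by move=> i iI; rewrite adjmxE (wI _ iI) rmorph0 mul0r.
  rewrite big_imset/=; last by move=> k l _ _; exact: maxrankfun_inj.
  by apply: eq_big => // k _; rewrite adjmxE !mxE.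
have wx0 : Y *m x = 0.
  apply/matrixP => i j; rewrite ord1 [RHS]mxE.
  have [/imsetP[k _ ->]|/wI//] := boolP (i \in I).
  have uk : u 0 k = conjc (w (f k) 0) by rewrite mxE.
  by apply/eqP; rewrite -/w -conjc_eq0 -uk u0 mxE.
by apply: Fi; rewrite FE mul_col_mx X0 wx0 col_mx0.
Qed.

Lemma BI_BI_dmx I K :
  adj (BI R K) *m BI R I = dmx R (fun k => (k \in K) == (k \in I)).
Proof.
rewrite adj_col_mx mul_row_col !dmx_adj !dmxM; apply/matrixP => i j.
rewrite !mxE -mulrnDl.
by case: (_ \in K); case: (_ \in I); rewrite ?addr0 ?add0r.
Qed.

(** It reduces membership in the chart of [K] to the invertibility of the principal block of [T] on
    the symmetric difference of [I] and [K]. *)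
Lemma flip_kernel I K T (x : 'cV[C]_n) : adj (BI R K) *m graph_frame I T *m x = 0 ->
  forall k, if (k \in K) == (k \in I) then x k 0 = 0 else (T *m x) k 0 = 0.
Proof.
have BC : adj (BI R K) *m CI R I =
    dmx R (fun k => (k \notin K) && (k \in I)) - dmx R (fun k => (k \in K) && (k \notin I)).
  by rewrite adj_col_mx mul_row_col !dmx_adj mulmxN !dmxM addrC.
rewrite /graph_frame mulmxDr mulmxA BI_BI_dmx BC mulmxDl -(mulmxA _ T) => E k.
have := congr1 (fun w : 'cV[C]_n => w k 0) E.
rewrite mulmxBl [X in X = _]mxE dmx_entry [RHS]mxE; set w := T *m x.
rewrite [X in _ + X = _]mxE [X in _ + (_ + X) = _]mxE !dmx_entry.
case: (k \in K); case: (k \in I) => /=; rewrite ?(addr0, add0r, subr0, oppr0) //.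
by move=> /eqP; rewrite oppr_eq0 => /eqP.
Qed.

Variable alpha : 'I_n -> R.
Hypothesis alpha_gt0 : forall i, 0 < alpha i.
Hypothesis alpha_incr : forall i j : 'I_n, (i < j)%N -> alpha i < alpha j.

(** The set is read as a binary number: both deleting an element and trading it for a smaller one
    decrease the value. *)
Definition height I := (\sum_(i in I) 2 ^ i)%N.

Lemma height_D1 I (j : 'I_n) : j \in I -> (height (I :\ j) < height I)%N.
Proof.
by move=> jI; rewrite /height (big_setD1 j jI) -[ltnLHS]add0n ltn_add2r expn_gt0.
Qed.

Lemma height_flip I (i j : 'I_n) : (i < j)%N -> j \in I -> i \notin I ->
  (height (i |: (I :\ j)) < height I)%N.
Proof.
move=> ij jI iI; rewrite /height big_setU1/= ?(big_setD1 j jI) ?ltn_add2r ?ltn_exp2l//.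
by rewrite !finset.inE (negPf iI) andbF.
Qed.

Lemma flip_unit I K T : (forall x : 'cV[C]_n, (forall k, if (k \in K) == (k \in I) then x k 0 = 0
   else (T *m x) k 0 = 0) -> x = 0) -> adj (BI R K) *m graph_frame I T \in unitmx.
Proof. by move=> xK; apply: injmx_unit => x /flip_kernel/xK. Qed.

(* Among the charts that contain [L], take the one of least [height]. If [T] had
   a nonzero entry [T i j] with [j = max i j] in [I], then [L] would be in the
   chart obtained by exchanging [j] if [T j j != 0], and else [i] and [j], in
   contradiction with the minimality. *)
Lemma Lag_cover L : Lag_h L -> exists I, Wminus alpha I L.
Proof.
move=> LL; have [F Fi LE] := Lag_colspan LL.
have F0 : adj F *m Jmx R n *m F = 0 by apply/(Lag_frame Fi); rewrite -LE.
have [I0 I0u] := Lag_transverse Fi F0.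
pose P I := adj (BI R I) *m F \in unitmx.
case: (@arg_minnP _ I0 P height I0u) => I Iu Imin.
have [a aE] : exists a, colspan F = colspan (graph_frame I (herm a)).
  by apply: Lag_chart => //; rewrite -LE.
have gru K : adj (BI R K) *m graph_frame I (herm a) \in unitmx -> (height I <= height K)%N.
  move=> Ku; apply: Imin; rewrite /P; apply/(dom_emb K Fi); rewrite aE.
  by apply/(dom_emb K (@injmx_gr _ _ I (herm a))).
exists I; apply/(WminusE alpha_gt0 alpha_incr); exists a; last by rewrite LE aE.
apply: supp_herm => [i j|]; first by rewrite omaxC.
have TC i j : herm a i j = 0 -> herm a j i = 0.
  by move=> Tij; rewrite -[herm a]herm_adj adjmxE Tij rmorph0.
move=> i j; rewrite negbK; wlog ij : i j / (i <= j)%N => [wlg|].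
  by have [/wlg//|/ltnW/wlg ji] := leqP i j; rewrite omaxC => /ji/TC.
rewrite /ordmax2 ij => jI; apply/eqP/negP => /negP Tij.
have [Tjj|Tjj] := eqVneq (herm a j j) 0; last first.
  suff /gru : adj (BI R (I :\ j)) *m graph_frame I (herm a) \in unitmx.
    by rewrite leqNgt height_D1.
  apply: flip_unit => x xP.
  have x0 k : k != j -> x k 0 = 0.
    by move=> kj; have := xP k; rewrite !finset.inE kj eqxx.
  apply/matrixP => k l; rewrite ord1 [RHS]mxE; have [->|/x0//] := eqVneq k j.
  have := xP j; rewrite !finset.inE eqxx jI /= mxE (bigD1 j)//= big1 ?addr0.
    by move/eqP; rewrite mulf_eq0 (negPf Tjj) => /eqP.
  by move=> p /x0 ->; rewrite mulr0.
have ij' : (i < j)%N.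
  by rewrite ltn_neqAle ij andbT; apply: contra_neq Tij => /val_inj ->.
have neij : i != j by rewrite -val_eqE neq_ltn ij'.
(* In both cases [K] differs from [I] exactly at [i] and [j]. The block of [T] on these indices has
   determinant [- |T i j|^2], as [T j j = 0], so it is invertible. *)
pose K := if i \in I then I :\ j :\ i else i |: (I :\ j).
have KE k : (k \in K) == (k \in I) = (k != i) && (k != j).
  rewrite /K; case: ifP => iI; rewrite !finset.inE.
    have [->|ki] := eqVneq k i; first by rewrite iI.
    by have [->|] := eqVneq k j; rewrite ?jI// eqxx.
  have [->|ki] := eqVneq k i; first by rewrite iI.
  by have [->|] := eqVneq k j; rewrite ?jI// eqxx.
suff /gru : adj (BI R K) *m graph_frame I (herm a) \in unitmx.
  rewrite leqNgt => /negP[]; rewrite /K; case: ifP => iI; last by rewrite height_flip ?iI.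
  by apply: (ltn_trans (height_D1 _)) (height_D1 jI); rewrite !finset.inE neij.
apply: flip_unit => x xP.
have x0 k : k != i -> k != j -> x k 0 = 0 by move=> ki kj; have := xP k; rewrite KE ki kj.
have Tx k : (herm a *m x) k 0 = herm a k i * x i 0 + herm a k j * x j 0.
  rewrite mxE (bigD1 i)//= (bigD1 j) 1?eq_sym//= big1 ?addr0// => p /andP[pi pj].
  by rewrite x0// mulr0.
have xi0 : x i 0 = 0.
  have := xP j; rewrite KE eqxx andbF Tx Tjj mul0r addr0 => /eqP.
  rewrite mulf_eq0 => /orP[/eqP/TC Tji|/eqP//].
  by rewrite Tji eqxx in Tij.
have xj0 : x j 0 = 0.
  have := xP i; rewrite KE eqxx /= Tx xi0 mulr0 add0r => /eqP.
  by rewrite mulf_eq0 (negPf Tij) => /eqP.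
apply/matrixP => k l; rewrite ord1 [RHS]mxE.
have [->//|ki] := eqVneq k i; have [->//|kj] := eqVneq k j; exact: x0.
Qed.

End Cover.

(** * The theorem *)

Section Strata.
Variables (R : realType) (n : nat) (alpha : 'I_n -> R).
Hypothesis alpha_gt0 : forall i, 0 < alpha i.
Hypothesis alpha_incr : forall i j : 'I_n, (i < j)%N -> alpha i < alpha j.
Local Notation W I := (@emb R n @` Wminus alpha I).
Local Notation W' I := (@emb R n @` Wplus alpha I).
Local Notation Lag := (@emb R n @` @Lag_h R n).
Implicit Types (I K : {set 'I_n}).

Lemma W_phi I p : W I p <-> exists2 A, supp (fun i j => ordmax2 i j \notin I) A & p = lag_phi I A.
Proof. exact: emb_phi (WminusE alpha_gt0 alpha_incr I) p. Qed.

Lemma W'_phi I p :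
  W' I p <-> exists2 A, supp (fun i j => ~~ (ordmax2 i j \notin I)) A & p = lag_phi I A.
Proof.
have -> : (fun i j => ~~ (ordmax2 i j \notin I)) = (fun i j => ordmax2 i j \in I).
  by apply/funext => i; apply/funext => j; rewrite negbK.
exact: emb_phi (WplusE alpha_gt0 alpha_incr I) p.
Qed.

Lemma W_Lag I : W I `<=` Lag.
Proof. by move=> _ [L [LL _] <-]; exists L. Qed.

Lemma W'_Lag I : W' I `<=` Lag.
Proof. by move=> _ [L [LL _] <-]; exists L. Qed.

Lemma W_dom I K p : W K p -> lag_dom I p -> exists a, p = lag_phi I a.
Proof. by move=> /W_Lag; exact: Lag_dom. Qed.

(** The products of the two coordinate frames form the diagonal 0-1 matrix of the indices where [I]
    and [K] agree; equal spans make it invertible, so no index is missing. *)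
Lemma emb_Lambda_inj I K : emb (Lambda R I) = emb (Lambda R K) -> I = K.
Proof.
move=> /emb_inj; rewrite !Lambda_colspan => IK.
have Ii (J : {set 'I_n}) : injmx (BI R J).
  by apply: (injmx_left (G := adjmx (@conjc R) (BI R J))); rewrite BI_BI unitmx1.
have : lag_dom K (emb (colspan (BI R I))).
  by rewrite IK; apply/dom_emb => //; rewrite BI_BI unitmx1.
move=> /(dom_emb K (Ii I)); rewrite BI_BI_dmx => dKI; apply/setP => k.
apply/eqP; rewrite eq_sym; apply: contraTT isT => /negPf kIK.
have d0 : dmx R (fun k => (k \in K) == (k \in I)) *m delta_mx k 0 = 0 :> 'cV_n.
  apply/matrixP => i j; rewrite ord1 dmx_entry [RHS]mxE mxE.
  by have [->|] := eqVneq i k; rewrite ?kIK//; case: ifP.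
have /matrixP/(_ k 0) : delta_mx k 0 = 0 :> 'cV[R[i]]_n.
  by rewrite -(mulKmx dKI (delta_mx k 0)) d0 mulmx0.
by rewrite !mxE !eqxx => /eqP; rewrite oner_eq0.
Qed.

Lemma W_disjoint I K p : W I p -> W K p -> I = K.
Proof.
move=> [L [_ LI] <-] [L' [_ LK] /emb_inj LL']; rewrite LL' in LK.
by apply: emb_Lambda_inj; exact: mx_cvg_unique LI LK.
Qed.

Lemma submanifold_cell I (Q : 'I_n -> 'I_n -> bool)
    (X : set 'cV[R]_((n + n) * (n + n) + (n + n) * (n + n))) :
  (forall p, X p <-> exists2 A : 'M[R]_n, supp Q A & p = lag_phi I A) ->
  submanifold (support_card Q) X.
Proof.
move=> XE; apply: submanifold_chart => p Xp; exists (lag_phi I), (@lag_rho R n I), (lag_dom I).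
split; first exact: phi_chart.
  by have [A _ ->] := (XE p).1 Xp; exact: chart_dom (phi_chart R I) A.
move=> q; split=> [[/XE//]|[b bQ ->]]; split; last exact: chart_dom (phi_chart R I) b.
by apply/XE; exists b.
Qed.

Lemma Lag_bigcup : Lag = \bigcup_I W I.
Proof.
apply/seteqP; split=> [_ [L LL <-]|p [I _ WI]]; last exact: W_Lag WI.
by have [I WI] := Lag_cover alpha_gt0 alpha_incr LL; exists I => //; exists L.
Qed.

(** The covering by cells supplies the charts: each point is in the chart centred at the limit of
    its cell. *)
Lemma submanifold_Lag : submanifold (support_card (fun _ _ : 'I_n => true)) Lag.
Proof.
apply: submanifold_chart => p Lp; have [I _ /W_phi[A _ ->]] : (\bigcup_I W I) p.
  by rewrite -Lag_bigcup.
exists (lag_phi I), (@lag_rho R n I), (lag_dom I); split; first exact: phi_chart.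
  exact: chart_dom (phi_chart R I) A.
move=> q; split=> [[Lq /(Lag_dom Lq)[a ->]]|[b _ ->]]; first by exists a.
by split; [exact: Lag_phi|exact: chart_dom (phi_chart R I) b].
Qed.

End Strata.

Theorem corollary3p7 (R : realType) (n : nat) (alpha : 'I_n -> R)
  (alpha_gt0 : forall i, 0 < alpha i)
  (alpha_incr : forall i j : 'I_n, (i < j)%N -> alpha i < alpha j) :
  whitney_stratification (fun I : {set 'I_n} => @emb R n @` Wminus alpha I)
    (@emb R n @` @Lag_h R n) /\
  (forall I K : {set 'I_n},
     transverse (@emb R n @` @Lag_h R n)
       (@emb R n @` Wminus alpha I) (@emb R n @` Wplus alpha K)).
Proof.
have translate I K a s := @Wminus_translate R n alpha alpha_gt0 alpha_incr I K a s.
have scale I K a c := @Wminus_scale R n alpha alpha_gt0 alpha_incr I K a c.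
have WE I p := W_phi alpha_gt0 alpha_incr I p.
have Wd I K := @W_dom R n alpha I K.
split; last first.
  (* The chart is centred at [Lambda K]: there [Wplus K] is a coordinate subspace, and [Wminus I] is
     invariant under translations by the complementary one. *)
  move=> I K; apply: (transverse_chart (Q := fun i j => ordmax2 i j \notin K)
    _ _ _ _ _ (phi_chart R K)).
  - by eexists; exact: submanifold_Lag alpha_gt0 alpha_incr.
  - by eexists; exact: submanifold_cell (WE I).
  - by eexists; exact: submanifold_cell (W'_phi alpha_gt0 alpha_incr K).
  - exact: W_Lag.
  - exact: W'_Lag.
  - exact: Lag_phi.
  - exact: Lag_dom.
  - exact: translate.
  - exact: W'_phi.
(* With indices counted from 0, there are [2 k + 1] pairs of maximum [k], so the dimension is the
   sum of [2 k + 1] over [k] outside [I]. *)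
exists (fun I : {set 'I_n} => support_card (fun i j : 'I_n => ordmax2 i j \notin I)); split.
- exact: Lag_bigcup.
- by move=> I K _ _ [p [WI WK]]; exact: (W_disjoint WI WK).
- move=> I; split.
  + by exists (lag_phi I 0); apply/WE; exists 0 => // i j _; rewrite mxE.
  + rewrite (_ : _ @` _ = lag_phi I @` supp (fun i j => ordmax2 i j \notin I)).
      exact: connected_chart_supp (phi_chart R I) _.
    by apply/seteqP; split=> [p /WE[A AQ ->]|_ [A AQ <-]]; [exists A|apply/WE; exists A].
  + exact: submanifold_cell (WE I).
- move=> I K IK IKn0; split.
    exact: (frontier_chart (phi_chart R I) (translate I K) (Wd I K) (WE I)).
  have [p [Ip Kp]] := IKn0.
  have [a Ka _] := closure_chart (phi_chart R I) (Wd I K) (WE I) Ip Kp.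
  apply: (support_card_lt (phi_chart R I) (phi_chart R K) (translate I K) (scale I K) _ Ka).
    by move=> q /WE.
  (* If [a] had its support in [Q], the point would belong to both cells, which are disjoint. *)
  move=> aQ; case/eqP: IK; apply: (W_disjoint (p := lag_phi I a)) Ka.
  by apply/WE; exists a.
- move=> I K IK _; split.
    exact: (whitney_a_chart (phi_chart R I) (translate I K) (scale I K) (Wd I K) (WE I)).
  exact: (whitney_b_chart (phi_chart R I) (translate I K) (scale I K) (Wd I K) (WE I)).
Qed.
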